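(* Let $k$ be a field and let $Q$ be an interval finite quiver. Assume $I$ is an indecomposable injective object in $\mathrm{fp}(Q)$. Then either (i) $I \simeq I_a$ for some vertex $a$ such that $a$ admits only finitely many predecessors $b$ and $b^+$ is finite for each such predecessor $b$; or (ii) $I \simeq Y_{[p]}$ for some equivalence class $[p]$ of left infinite paths in $Q$ such that $\operatorname{supp} Y_{[p]}$ is top finite and uniformly interval finite and the set $\bigcup_{a \in \operatorname{supp} Y_{[p]}} a^+ \setminus \operatorname{supp} Y_{[p]}$ is finite.
   Context: A quiver $Q=(Q_0,Q_1)$ has a (possibly infinite) vertex set $Q_0$ and arrow set $Q_1$; an arrow $\alpha$ goes from its source $s(\alpha)$ to its target $t(\alpha)$. Paths are written right to left, $\alpha_l\cdots\alpha_1$ with $s(\alpha_{i+1})=t(\alpha_i)$, and each vertex $a$ has a trivial path $e_a$. $Q(a,b)$ is the set of paths from $a$ to $b$ (including trivial ones). $Q$ is interval finite if $Q(a,b)$ is finite for all $a,b\in Q_0$. If $Q(a,b)\neq\emptyset$, $a$ is a predecessor of $b$ and $b$ a successor of $a$. $a^+$ is the set of vertices $b$ with some arrow $a\to b$. A quiver is top finite if there are finitely many vertices such that every vertex is a successor of one of them. A quiver is uniformly interval finite if there is a positive integer $Z$ such that the number of paths from $a$ to $b$ is at most $Z$ for all vertices $a,b$. A left infinite path is an infinite sequence of arrows $p=\cdots\alpha_n\cdots\alpha_2\alpha_1$ with $s(\alpha_{i+1})=t(\alpha_i)$ for all $i\ge1$; $s(p)=s(\alpha_1)$. Two left infinite paths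 $\cdots\alpha_2\alpha_1$ and $\cdots\beta_2\beta_1$ are equivalent if there are positive integers $m,n$ with $\cdots\alpha_{m+1}\alpha_m=\cdots\beta_{n+1}\beta_n$ (as sequences). $[p]$ is the equivalence class of $p$ and $[p]_a$ is the set of $u\in[p]$ with $s(u)=a$. $\mathrm{Rep}(Q)$ is the abelian category of representations $M=(M(a),M(\alpha))$ of $Q$ by (arbitrary) $k$-vector spaces and linear maps. $\operatorname{supp}M$ is the full subquiver on the vertices $a$ with $M(a)\ne0$; ''$a\in\operatorname{supp}M$'' and set differences with $\operatorname{supp}M$ refer to its vertices. $P_a$ is the representation with $P_a(b)=\bigoplus_{p\in Q(a,b)}kp$ and $P_a(\alpha)(p)=\alpha p$. $I_a$ is the representation with $I_a(b)=\mathrm{Hom}_k(\bigoplus_{p\in Q(b,a)}kp,k)$ and, for $\alpha:b\to b'$, $I_a(\alpha)(f)=(p\mapsto f(p\alpha))$. $Y_{[p]}$ is the representation with $Y_{[p]}(a)=\mathrm{Hom}_k(\bigoplus_{u\in[p]_a}ku,k)$ and, for $\alpha:a\to b$, $Y_{[p]}(\alpha)(f)=(u\mapsto f(u\alpha))$. $M$ is finitely generated if there is an epimorphism $f:\bigoplus_{i=1}^nP_{a_i}\to M$ (finite sum), and finitely presented if moreover $\operatorname{Ker}f$ is finitely generated. $\mathrm{fp}(Q)$ is the full subcategory of $\mathrm{Rep}(Q)$ of finitely presented representations; it is an abelian subcategory (kernels and cokernels as in $\mathrm{Rep}(Q)$). An injective object in $\mathrm{fp}(Q)$ is an injective object of this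 abelian category. *)

(* Defs.v *)
From HB Require Import structures.
From mathcomp Require Import all_boot all_algebra.
From mathcomp Require Import boolp classical_sets functions cardinality.
From mathcomp.multinomials Require Import freeg.

Set Implicit Arguments.
Unset Strict Implicit.
Unset Printing Implicit Defensive.

Import GRing.Theory.
Local Open Scope classical_set_scope.
Local Open Scope card_scope.
Local Open Scope ring_scope.

Record quiver := Quiver {
  vertex : choiceType;
  arrow : choiceType;
  source : arrow -> vertex;
  target : arrow -> vertex }.

Section Paths.
Variable Q : quiver.
Implicit Types (a b c : vertex Q) (al : arrow Q) (w : seq (arrow Q)).

(* A path is the list of its arrows in the order of travel: the path written
   alpha_l ... alpha_1 from right to left is [:: alpha_1; ...; alpha_l]. *)
Fixpoint is_path a w b : bool :=
  if w is al :: w' then (source al == a) && is_path (target al) w' b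
  else a == b.

Definition qpath a b := {w : seq (arrow Q) | is_path a w b}.

Lemma is_path_rcons a w al :
  is_path a w (source al) -> is_path a (rcons w al) (target al).
Proof.
elim: w a => [|be w IHw] a /=; first by move/eqP->; rewrite !eqxx.
by case/andP=> -> /IHw.
Qed.

Lemma is_path_cons w al c :
  is_path (target al) w c -> is_path (source al) (al :: w) c.
Proof. by move=> /= ->; rewrite eqxx. Qed.

Definition path_after a al (p : qpath a (source al)) : qpath a (target al) :=
  exist _ (rcons (val p) al) (is_path_rcons (valP p)).

Definition path_before c al (p : qpath (target al) c) : qpath (source al) c :=
  exist _ (al :: val p) (is_path_cons (valP p)).

Definition predecessors b : set (vertex Q) :=
  [set a | [set: qpath a b] !=set0].

Definition out_vertices a : set (vertex Q) :=
  [set b | exists2 al, source al = a & target al = b].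

Definition is_left_path (p : nat -> arrow Q) : Prop :=
  forall i, source (p i.+1) = target (p i).

(* The arrow alpha_(i+1) of  ... alpha_2 alpha_1  is the value at i. *)
Definition left_path := {p : nat -> arrow Q | `[< is_left_path p >]}.

Definition left_source (p : left_path) : vertex Q := source (val p 0%N).

Definition left_equiv (p q : left_path) : Prop :=
  exists m n : nat, forall i, val p (m + i)%N = val q (n + i)%N.

Definition left_class (p : left_path) a :=
  {u : left_path | `[< left_equiv u p >] && (left_source u == a)}.

Definition left_cons al (u : nat -> arrow Q) : nat -> arrow Q :=
  fun i => if i is j.+1 then u j else al.

Lemma left_cons_path al (u : left_path) :
  left_source u == target al -> `[< is_left_path (left_cons al (val u)) >].
Proof.
move=> /eqP hu; apply/asboolP=> -[|i] //=.
by case: u {hu} => u /= /asboolP hu; apply: hu.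
Qed.

Definition left_before_path al (u : left_path)
    (hu : left_source u == target al) : left_path :=
  exist _ (left_cons al (val u)) (left_cons_path hu).

Lemma left_before_subproof (p : left_path) al (u : left_path)
    (hu : `[< left_equiv u p >] && (left_source u == target al)) :
  `[< left_equiv (left_before_path (proj2 (andP hu))) p >]
    && (left_source (left_before_path (proj2 (andP hu))) == source al).
Proof.
apply/andP; split; last exact: eqxx.
have /andP[/asboolP[m [n mnP]] _] := hu.
by apply/asboolP; exists m.+1, n => i; rewrite addSn /= mnP.
Qed.

Definition left_before (p : left_path) al (u : left_class p (target al)) :
    left_class p (source al) :=
  exist _ (left_before_path (proj2 (andP (valP u))))
    (left_before_subproof (valP u)).

End Paths.

Definition interval_finite (Q : quiver) : Prop :=
  forall a b : vertex Q, finite_set [set: qpath a b].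

Definition uniformly_interval_finite (Q : quiver) : Prop :=
  exists2 Z : nat, (0 < Z)%N &
    forall a b : vertex Q, [set: qpath a b] #<= `I_Z.

Definition top_finite (Q : quiver) : Prop :=
  exists2 A : set (vertex Q), finite_set A &
    forall b : vertex Q, exists2 a, A a & predecessors b a.

Definition full_subquiver (Q : quiver) (S : set (vertex Q)) : quiver :=
  @Quiver {a : vertex Q | a \in S}
    {al : arrow Q | (source al \in S) && (target al \in S)}
    (fun al => exist _ (source (val al)) (proj1 (andP (valP al))))
    (fun al => exist _ (target (val al)) (proj2 (andP (valP al)))).

Lemma linear_ext (R : pzRingType) (U V : lmodType R) (f g : {linear U -> V}) :
  f =1 g -> f = g.
Proof.
case: f g => [f [[f1] [f2]]] [g [[g1] [g2]]] /= /funext fg.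
move: f1 f2 g1 g2; rewrite fg => f1 f2 g1 g2.
by rewrite (Prop_irrelevance f1 g1) (Prop_irrelevance f2 g2).
Qed.

Definition dual (k : fieldType) (V : lmodType k) : Type := {linear V -> k^o}.

Section Dual.
Variables (k : fieldType) (V : lmodType k).

HB.instance Definition _ := gen_eqMixin (dual V).
HB.instance Definition _ := gen_choiceMixin (dual V).

Let dual_zero : dual V := \0.
Let dual_opp (f : dual V) : dual V := \- (f : {linear V -> k^o}).
Let dual_add (f g : dual V) : dual V :=
  (f : {linear V -> k^o}) \+ (g : {linear V -> k^o}).
Let dual_scale (c : k) (f : dual V) : dual V :=
  c \*: (f : {linear V -> k^o}).

Let dual_addA : associative dual_add.
Proof. by move=> f g h; apply: linear_ext => x /=; rewrite addrA. Qed.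

Let dual_addC : commutative dual_add.
Proof. by move=> f g; apply: linear_ext => x /=; rewrite addrC. Qed.

Let dual_add0 : left_id dual_zero dual_add.
Proof. by move=> f; apply: linear_ext => x /=; rewrite add0r. Qed.

Let dual_addN : left_inverse dual_zero dual_opp dual_add.
Proof. by move=> f; apply: linear_ext => x /=; rewrite addNr. Qed.

HB.instance Definition _ :=
  GRing.isZmodule.Build (dual V) dual_addA dual_addC dual_add0 dual_addN.

Let dual_scaleA c d f : dual_scale c (dual_scale d f) = dual_scale (c * d) f.
Proof. by apply: linear_ext => x /=; rewrite scalerA. Qed.

Let dual_scale1 : left_id 1 dual_scale.
Proof. by move=> f; apply: linear_ext => x /=; rewrite scale1r. Qed.

Let dual_scaleDr : right_distributive dual_scale +%R.
Proof. by move=> c f g; apply: linear_ext => x /=; rewrite scalerDr. Qed.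

Let dual_scaleDl f : {morph dual_scale^~ f : c d / c + d}.
Proof. by move=> c d; apply: linear_ext => x /=; rewrite scalerDl. Qed.

HB.instance Definition _ := GRing.Zmodule_isLmodule.Build k (dual V)
  dual_scaleA dual_scale1 dual_scaleDr dual_scaleDl.

End Dual.

Section Transpose.
Variables (k : fieldType) (U V : lmodType k) (phi : {linear U -> V}).

Definition transpose (f : dual V) : dual U :=
  (f : {linear V -> k^o}) \o phi.

Let transpose_linear : linear transpose.
Proof. by move=> c f g; apply: linear_ext. Qed.

HB.instance Definition _ :=
  GRing.isLinear.Build k (dual V) (dual U) *:%R transpose transpose_linear.
End Transpose.

Section FreeLift.
Variables (k : fieldType) (K : choiceType) (V : lmodType k) (f : K -> V).

Lemma fglift_linear : linear (fglift f : {freeg K / k} -> V).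
Proof.
have hB := @lift_is_additive k K V f.
have h0 : fglift f 0 = 0 by rewrite -(subrr 0) hB subrr.
have hN D : fglift f (- D) = - fglift f D by rewrite -sub0r hB h0 sub0r.
have hD D E : fglift f (D + E) = fglift f D + fglift f E.
  by rewrite -[E in LHS]opprK hB hN opprK.
have hU (c a : k) x : c *: [freeg [:: (a, x)]] = [freeg [:: (c * a, x)]].
  by apply/eqP/freeg_eqP => y; rewrite coeffZ !coeffU mulrA.
move=> c D E; rewrite hD; congr (_ + _).
rewrite -[D]freeg_sumE scaler_sumr !(big_morph _ hD h0) scaler_sumr.
by apply: eq_bigr => x _; rewrite hU !liftU scalerA.
Qed.

End FreeLift.

(* {freeg K / k} is the vector space with basis K; free_map f is the linear
   map sending the basis vector x to the basis vector f x. *)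
Section FreeMap.
Variables (k : fieldType) (K L : choiceType) (f : K -> L).

Definition free_map : {freeg K / k} -> {freeg L / k} :=
  fglift (fun x => [freeg [:: (1, f x)]]).

HB.instance Definition _ :=
  GRing.isLinear.Build k {freeg K / k} {freeg L / k} *:%R free_map
    (fglift_linear _).
End FreeMap.

Section Kernel.
Variables (k : fieldType) (U V : lmodType k) (f : {linear U -> V}).

Definition in_ker : {pred U} := fun x => f x == 0.

Lemma in_ker_submod : submod_closed in_ker.
Proof.
split=> [|c x y]; rewrite !unfold_in ?linear0 //.
by move=> /eqP fx /eqP fy; rewrite linearP fx fy scaler0 addr0.
Qed.
HB.instance Definition _ :=
  GRing.isSubmodClosed.Build k U in_ker in_ker_submod.

Record ker_space := KerSpace { ker_val : U; _ : ker_val \in in_ker }.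
HB.instance Definition _ := [isSub for ker_val].
HB.instance Definition _ := [Choice of ker_space by <:].
HB.instance Definition _ := [SubChoice_isSubLmodule of ker_space by <:].
End Kernel.

Section Representations.
Variables (k : fieldType) (Q : quiver).

Record rep := Rep {
  space :> vertex Q -> lmodType k;
  act : forall al : arrow Q,
    {linear space (source al) -> space (target al)} }.

Record rep_hom (M N : rep) := Hom {
  hom_fun :> forall a, {linear M a -> N a};
  hom_natural : forall al (x : M (source al)),
    hom_fun (target al) (act M al x) = act N al (hom_fun (source al) x) }.

Definition hom_eq (M N : rep) (f g : rep_hom M N) : Prop :=
  forall a (x : M a), f a x = g a x.

Lemma hom_id_natural (M : rep) al (x : M (source al)) :
  idfun (act M al x) = act M al (idfun x).
Proof. by []. Qed.

Definition hom_id (M : rep) : rep_hom M M :=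
  @Hom M M (fun a => idfun) (@hom_id_natural M).

Lemma hom_comp_natural (L M N : rep) (g : rep_hom M N) (f : rep_hom L M) al
    (x : L (source al)) :
  (g (target al) \o f (target al)) (act L al x)
  = act N al ((g (source al) \o f (source al)) x).
Proof. by rewrite /= !hom_natural. Qed.

Definition hom_comp (L M N : rep) (g : rep_hom M N) (f : rep_hom L M) :
    rep_hom L N :=
  @Hom L N (fun a => g a \o f a) (hom_comp_natural g f).

Definition rep_iso (M N : rep) : Prop :=
  exists (f : rep_hom M N) (g : rep_hom N M),
    hom_eq (hom_comp g f) (hom_id M) /\ hom_eq (hom_comp f g) (hom_id N).

(* In the _in notions, C stands for the full subcategory of Rep(Q) on the
   objects satisfying it; test objects are taken in that subcategory. *)

Definition mono_in (C : rep -> Prop) (M N : rep) (f : rep_hom M N) : Prop :=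
  forall (L : rep) (g h : rep_hom L M), C L ->
    hom_eq (hom_comp f g) (hom_comp f h) -> hom_eq g h.

Definition epi (M N : rep) (f : rep_hom M N) : Prop :=
  forall (L : rep) (g h : rep_hom N L),
    hom_eq (hom_comp g f) (hom_comp h f) -> hom_eq g h.

Definition injective_in (C : rep -> Prop) (I : rep) : Prop :=
  C I /\
  forall (M N : rep) (f : rep_hom M N), C M -> C N -> mono_in C f ->
    forall g : rep_hom M I, exists h : rep_hom N I, hom_eq (hom_comp h f) g.

Definition rep_zero (M : rep) : Prop := forall a (x : M a), x = 0.

Definition rep0 : rep := @Rep (fun=> 'rV[k]_0 : lmodType k) (fun=> idfun).

Section Biproduct.
Variables M N : rep.

Definition oplus_act al (x : M (source al) * N (source al)) :
    M (target al) * N (target al) := (act M al x.1, act N al x.2).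

Lemma oplus_act_linear al : linear (@oplus_act al).
Proof. by move=> c x y; rewrite /oplus_act !linearP. Qed.

HB.instance Definition _ al :=
  GRing.isLinear.Build k (M (source al) * N (source al))%type
    (M (target al) * N (target al))%type *:%R (@oplus_act al)
    (@oplus_act_linear al).

Definition oplus : rep :=
  @Rep (fun a => (M a * N a)%type : lmodType k) (fun al => @oplus_act al).
End Biproduct.

Definition indecomposable_in (C : rep -> Prop) (M : rep) : Prop :=
  [/\ C M, ~ rep_zero M &
    forall M1 M2 : rep, C M1 -> C M2 -> rep_iso M (oplus M1 M2) ->
      rep_zero M1 \/ rep_zero M2].

Section KernelRep.
Variables (M N : rep) (f : rep_hom M N).

Lemma ker_act_subproof al (x : ker_space (f (source al))) :
  act M al (val x) \in in_ker (f (target al)).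
Proof.
rewrite unfold_in hom_natural.
by have := valP x; rewrite unfold_in => /eqP->; rewrite linear0.
Qed.

Definition ker_act al (x : ker_space (f (source al))) :
  ker_space (f (target al)) := KerSpace (ker_act_subproof x).

Lemma ker_act_linear al : linear (@ker_act al).
Proof. by move=> c x y; apply: val_inj; rewrite /= !linearP. Qed.

HB.instance Definition _ al :=
  GRing.isLinear.Build k (ker_space (f (source al)))
    (ker_space (f (target al))) *:%R (@ker_act al) (@ker_act_linear al).

Definition ker_rep : rep :=
  @Rep (fun a => ker_space (f a) : lmodType k) (fun al => @ker_act al).
End KernelRep.

Definition supp (M : rep) : set (vertex Q) :=
  [set a | exists x : M a, x <> 0].

Definition P_rep (a : vertex Q) : rep :=
  @Rep (fun b => {freeg (qpath a b) / k} : lmodType k)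
    (fun al => free_map (@path_after Q a al)).

Definition I_rep (a : vertex Q) : rep :=
  @Rep (fun b => dual {freeg (qpath b a) / k} : lmodType k)
    (fun al => transpose (free_map (@path_before Q a al))).

Definition Y_rep (p : left_path Q) : rep :=
  @Rep (fun a => dual {freeg (left_class p a) / k} : lmodType k)
    (fun al => transpose (free_map (@left_before Q p al))).

Definition P_sum (s : seq (vertex Q)) : rep :=
  foldr (fun a M => oplus (P_rep a) M) rep0 s.

Definition finitely_generated (M : rep) : Prop :=
  exists (s : seq (vertex Q)) (f : rep_hom (P_sum s) M), epi f.

Definition finitely_presented (M : rep) : Prop :=
  exists (s : seq (vertex Q)) (f : rep_hom (P_sum s) M),
    epi f /\ finitely_generated (ker_rep f).

End Representations.

(* Main.v *)
(** Let I be as in the statement.  Injectivity against the monomorphisms from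
sums of P_(t alpha) to P_a, for distinct arrows alpha starting at a, makes
I(a) -> prod I(t alpha) surjective; so supp I is closed under predecessors.
Finite presentation makes I(alpha) injective as soon as t(alpha) lies outside
the finite set V of vertices where the relations are generated.  Hence a vertex
of supp I has at most one outgoing arrow ending outside V, only finitely many
arrows starting in supp I end in V, and a path inside supp I is determined by
its endpoints and the arrows of this finite set that it uses.

If some nonzero x in I(b) is killed by all arrows, surjectivity lifts x along
all paths ending at b; the lifts are dual to the functionals "act along the
path, then apply a functional that is 1 at x", and this splits off I_b.
Otherwise a walk in supp I eventually follows a left infinite path p along which
I is bijective and no other arrow leaves; the same construction, starting from
a nonzero element transported along p, splits off Y_[p].  Direct summands of I
are finitely presented, so indecomposability concludes. *)

From Stdlib Require Eqdep_dec.
From HB Require Import structures.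
Require Import Defs.
From mathcomp Require Import all_boot all_algebra.
From mathcomp Require Import boolp classical_sets functions cardinality.
From mathcomp.multinomials Require Import freeg.

Set Implicit Arguments.
Unset Strict Implicit.
Unset Printing Implicit Defensive.

Import GRing.Theory.
Local Open Scope classical_set_scope.
Local Open Scope card_scope.
Local Open Scope ring_scope.

(** * Linear functionals and free vector spaces *)

Section LinearMaps.
Variable k : fieldType.

Fact mk_linear_key : unit. Proof. exact: tt. Qed.

(** Locked so that simplification keeps the map folded; it is evaluated through [mk_linearE]. *)
Definition mk_linear (U V : lmodType k) (f : U -> V) (hf : linear f) :
    {linear U -> V} :=
  locked_with mk_linear_key
    (HB.pack_for {linear U -> V} f (GRing.isLinear.Build k U V *:%R f hf)).

Lemma mk_linearE (U V : lmodType k) (f : U -> V) (hf : linear f) x :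
  mk_linear hf x = f x.
Proof. by rewrite /mk_linear unlock. Qed.

(** Zorn's lemma gives a maximal subspace [A] that contains [W] and misses [x]. By maximality [A]
    and [x] span [V], and the coordinate along [x] is the functional. *)
Lemma exists_functional (V : lmodType k) (W : set V) (x : V) :
  W 0 -> (forall c u v, W u -> W v -> W (c *: u + v)) -> ~ W x ->
  exists2 phi : {linear V -> k^o}, (forall w, W w -> phi w = 0) & phi x = 1.
Proof.
move=> W0 Wlin Wx.
pose good (A : set V) := [/\ W `<=` A, ~ A x &
  forall c u v, A u -> A v -> A (c *: u + v)].
pose P (A : set V) := A = set0 \/ good A.
have [F FP Ftot|A [PA Amax]] := @Zorn_bigcup _ P.
  have [[A0 FA0 gA0]|noF] := pselect (exists2 A, F A & good A); last first.
    left; apply/seteqP; split=> // v [A FA Av]; apply: noF; exists A => //.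
    by case: (FP A FA) => // A0; rewrite A0 in Av.
  have gA A v : F A -> A v -> good A.
    by move=> FA Av; case: (FP A FA) => // A0'; rewrite A0' in Av.
  right; split.
  - by move=> w Ww; exists A0 => //; case: gA0 => + _ _; apply.
  - by move=> [A FA Ax]; case: (gA _ _ FA Ax).
  - move=> c u v [A FA Au] [B FB Bv].
    have [AB|BA] := Ftot _ _ FA FB.
      by exists B => //; case: (gA _ _ FB Bv) => _ _; apply=> //; apply: AB.
    by exists A => //; case: (gA _ _ FA Au) => _ _; apply=> //; apply: BA.
have [WA Ax Alin] : good A.
  case: PA => // A0; exfalso.
  apply: (Amax W); last by right; split.
  rewrite A0; split; first exact: sub0set.
  by move=> /(_ 0 W0).
have A0 : A 0 by apply: WA.
have AZ c u : A u -> A (c *: u) by move=> Au; rewrite -[_ *: _]addr0; apply: Alin.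
have AD u v : A u -> A v -> A (u + v).
  by move=> Au Av; rewrite -[u]scale1r; apply: Alin.
have AB u v : A u -> A v -> A (u - v).
  by move=> Au Av; rewrite -scaleN1r addrC; apply: Alin.
have coord v : exists c, A (v - c *: x).
  have [Av|Av] := pselect (A v); first by exists 0; rewrite scale0r subr0.
  (* [B] is the span of [A] and [v]. If it contains [x], solving for [v] gives the coordinate;
     otherwise it contradicts the maximality of [A]. *)
  pose B := [set u | exists c, A (u - c *: v)].
  have [Bx|Bx] := pselect (B x).
    have [c Ac] := Bx.
    have c0 : c != 0 by apply/eqP => c0; move: Ac; rewrite c0 scale0r subr0.
    exists c^-1; move: (AZ (- c^-1) _ Ac).
    by rewrite scalerBr scalerA mulNr mulVf // !scaleNr scale1r opprK addrC.
  exfalso; apply: (Amax B).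
    split=> [u Au|/(_ v) BA]; first by exists 0; rewrite scale0r subr0.
    by apply/Av/BA; exists 1; rewrite scale1r subrr.
  right; split=> //.
  - by move=> w /WA Aw; exists 0; rewrite scale0r subr0.
  - move=> c u w [d Ad] [e Ae]; exists (c * d + e).
    have -> : c *: u + w - (c * d + e) *: v = c *: (u - d *: v) + (w - e *: v).
      by rewrite scalerBr scalerDl scalerA opprD addrACA.
    exact: Alin.
have coord_uniq v c d : A (v - c *: x) -> A (v - d *: x) -> c = d.
  move=> Ac Ad; have [//|] := eqVneq c d; rewrite -subr_eq0 => cd; exfalso.
  apply: Ax; have vcd : v - d *: x - (v - c *: x) = (c - d) *: x.
    by rewrite opprB addrC addrA subrK scalerBl.
  move: (AZ (c - d)^-1 _ (AB _ _ Ad Ac)).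
  by rewrite vcd scalerA mulVf // scale1r.
have [phi phiP] := choice coord.
have phi_lin : linear (phi : V -> k^o).
  move=> c u v; apply: (@coord_uniq (c *: u + v)) => //.
  have -> : c *: u + v - (c *: (phi u : k^o) + phi v) *: x
    = c *: (u - phi u *: x) + (v - phi v *: x).
    by rewrite scalerBr scalerDl scalerA opprD addrACA.
  exact: Alin.
exists (mk_linear phi_lin) => [w Ww|]; rewrite mk_linearE;
  apply: coord_uniq; try exact: phiP.
  by rewrite scale0r subr0; apply: WA.
by rewrite scale1r subrr.
Qed.

Lemma functional_neq0 (V : lmodType k) (x : V) : x <> 0 ->
  exists phi : {linear V -> k^o}, phi x = 1.
Proof.
move=> x0; have [//|c u v -> ->||phi _ phix] := @exists_functional V [set 0] x.
- by rewrite scaler0 addr0.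
- by move/x0.
- by exists phi.
Qed.

Lemma functional_bij (U V : lmodType k) (f : {linear U -> V})
    (phi : {linear U -> k^o}) :
  injective f -> (forall y, exists x, f x = y) ->
  exists psi : {linear V -> k^o}, forall x, psi (f x) = phi x.
Proof.
move=> finj /choice[g gK].
have psi_lin : linear (fun y => phi (g y) : k^o).
  move=> c u v; rewrite -linearP; congr (phi _).
  by apply: finj; rewrite linearP !gK.
by exists (mk_linear psi_lin) => x; rewrite mk_linearE; congr (phi _); apply: finj.
Qed.

End LinearMaps.

Notation fbasis x := [freeg [:: (1, x)]].

Section Free.
Variables (k : fieldType) (K : choiceType).

Definition free_lift (V : lmodType k) (f : K -> V) : {linear {freeg K / k} -> V} :=
  mk_linear (fglift_linear f).

Lemma free_liftE (V : lmodType k) (f : K -> V) x :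
  free_lift f (fbasis x) = f x.
Proof. by rewrite /free_lift mk_linearE liftU scale1r. Qed.

Lemma free_ext (V : lmodType k) (f g : {linear {freeg K / k} -> V}) :
  (forall x, f (fbasis x) = g (fbasis x)) -> forall D, f D = g D.
Proof.
move=> fg D; rewrite -[D]freeg_sumE !linear_sum; apply: eq_bigr => x _.
have -> : << coeff x D *g x >> = coeff x D *: (fbasis x : {freeg K / k}).
  by apply/eqP/freeg_eqP => y; rewrite coeffZ !coeffU mul1r.
by rewrite !linearZ fg.
Qed.

End Free.

Lemma free_mapE (k : fieldType) (K L : choiceType) (f : K -> L) (x : K) :
  free_map f (fbasis x : {freeg K / k}) = fbasis (f x).
Proof. by rewrite /free_map /= liftU scale1r. Qed.

(** * Path action, homomorphisms from P and into dual representations *)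

Section PathAction.
Variables (k : fieldType) (Q : quiver).
Implicit Types (M N : rep k Q) (a b c : vertex Q) (al be : arrow Q).
Implicit Types w : seq (arrow Q).

Definition castv M a b : {linear M a -> M b} :=
  match a =P b with
  | ReflectT e => match e in _ = b return {linear M a -> M b} with
                  | erefl => idfun end
  | ReflectF _ => \0
  end.

Lemma castv_id M a (x : M a) : castv M a a x = x.
Proof.
by rewrite /castv; case: eqP => // e; rewrite (eq_irrelevance e (erefl a)).
Qed.

(* Total, hence free of transports along equalities of vertices: it is the
   action of the path [w] if [w] leads from [a] to [b], and 0 otherwise. *)
Fixpoint pact M w a b : {linear M a -> M b} :=
  if w is al :: w' then
    pact M w' (target al) b \o (act M al \o castv M a (source al))
  else castv M a b.

Lemma pact_nil M a (x : M a) : pact M [::] a a x = x.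
Proof. exact: castv_id. Qed.

Lemma pact_cons M al w b (x : M (source al)) :
  pact M (al :: w) (source al) b x = pact M w (target al) b (act M al x).
Proof. by rewrite /= castv_id. Qed.

Lemma pact_rcons_cast M w al a b (x : M a) :
  pact M (rcons w al) a b x
  = castv M (target al) b (act M al (pact M w a (source al) x)).
Proof. by elim: w a x => [|be w IHw] a x /=; rewrite ?IHw. Qed.

Lemma pact_rcons M w al a (x : M a) :
  pact M (rcons w al) a (target al) x = act M al (pact M w a (source al) x).
Proof. by rewrite pact_rcons_cast castv_id. Qed.

Lemma hom_castv M N (f : rep_hom M N) a b (x : M a) :
  f b (castv M a b x) = castv N a b (f a x).
Proof.
have [<-|ab] := eqVneq a b; first by rewrite !castv_id.
by rewrite /castv; case: eqP => [e|_] /=; [case/eqP: ab | rewrite linear0].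
Qed.

Lemma hom_pact M N (f : rep_hom M N) w a b (x : M a) :
  f b (pact M w a b x) = pact N w a b (f a x).
Proof.
elim: w a x => [|al w IHw] a x /=; first exact: hom_castv.
by rewrite IHw hom_natural hom_castv.
Qed.

Lemma is_path_cat a w b w' c : is_path a w b -> is_path b w' c ->
  is_path a (w ++ w') c.
Proof.
elim: w a => [|al w IHw] a /=; first by move/eqP->.
by move=> /andP[-> /IHw h] /h ->.
Qed.

Lemma is_path_catE a w w' c : is_path a (w ++ w') c ->
  exists2 b, is_path a w b & is_path b w' c.
Proof.
elim: w a => [|al w IHw] a /=; first by exists a => //=.
by move=> /andP[-> /IHw].
Qed.

Lemma is_path_rconsE a w al b : is_path a (rcons w al) b ->
  is_path a w (source al) /\ target al = b.
Proof.
elim: w a => [|be w IHw] a /=; first by move=> /andP[/eqP-> /eqP->].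
by move=> /andP[-> /IHw].
Qed.

Definition trivial_path a : qpath a a := exist _ [::] (eqxx a : is_path a [::] a).

Section HomFromP.
Variables (M : rep k Q) (a : vertex Q) (x : M a).

(** Yoneda: an element [x] of [M a] yields the homomorphism out of [P_rep k a] that sends the
    trivial path to [x]. *)
Definition P_lift_fun b : {linear P_rep k a b -> M b} :=
  free_lift (fun q : qpath a b => pact M (val q) a b x).

Lemma P_lift_natural al (y : P_rep k a (source al)) :
  P_lift_fun (target al) (act (P_rep k a) al y)
  = act M al (P_lift_fun (source al) y).
Proof.
apply: (@free_ext _ _ _ (P_lift_fun (target al) \o act (P_rep k a) al)
  (act M al \o P_lift_fun (source al))) => q /=.
by rewrite free_mapE /P_lift_fun !free_liftE pact_rcons.
Qed.

Definition P_lift : rep_hom (P_rep k a) M := Defs.Hom P_lift_natural.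

Lemma P_liftE b (q : qpath a b) : P_lift b (fbasis q) = pact M (val q) a b x.
Proof. exact: free_liftE. Qed.

Lemma P_lift_trivial : P_lift a (fbasis (trivial_path a)) = x.
Proof. by rewrite P_liftE pact_nil. Qed.
End HomFromP.

(** Uniqueness half of Yoneda: the trivial path generates [P_rep k a], so one value determines a
    homomorphism. *)
Lemma pact_P a b (q : qpath a b) :
  pact (P_rep k a) (val q) a b (fbasis (trivial_path a)) = fbasis q.
Proof.
case: q => w wP /=; elim/last_ind: w b wP => [|w al IHw] b wP.
  have ab := eqP wP; subst b; rewrite pact_nil; congr (fbasis _); exact: val_inj.
have [wa alb] := is_path_rconsE wP; subst b.
rewrite pact_rcons (IHw _ wa) /= free_mapE; congr (fbasis _); exact: val_inj.
Qed.

Lemma P_hom_ext M a (f g : rep_hom (P_rep k a) M) :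
  f a (fbasis (trivial_path a)) = g a (fbasis (trivial_path a)) -> hom_eq f g.
Proof. by move=> fg b; apply: free_ext => q; rewrite -pact_P !hom_pact fg. Qed.

Definition zero_hom M N : rep_hom M N :=
  @Defs.Hom k Q M N (fun a => \0) (fun al x => esym (linear0 (act N al))).

Lemma sub_hom_natural M N (f g : rep_hom M N) al (x : M (source al)) :
  (f (target al) \- g (target al)) (act M al x)
  = act N al ((f (source al) \- g (source al)) x).
Proof. by rewrite /= !hom_natural linearB. Qed.

Definition sub_hom M N (f g : rep_hom M N) : rep_hom M N :=
  @Defs.Hom k Q M N (fun a => f a \- g a) (sub_hom_natural f g).

End PathAction.

Section DualRep.
Variables (k : fieldType) (Q : quiver) (U : vertex Q -> choiceType).
Variable cns : forall al : arrow Q, U (target al) -> U (source al).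

(* Common generalization of [I_rep] and [Y_rep]. *)
Definition J_rep : rep k Q :=
  @Rep k Q (fun a => dual {freeg (U a) / k} : lmodType k)
    (fun al => transpose (free_map (@cns al))).

Lemma J_ext a (f g : J_rep a) :
  (forall u, (f : {linear {freeg (U a) / k} -> k^o}) (fbasis u)
    = (g : {linear {freeg (U a) / k} -> k^o}) (fbasis u)) -> f = g.
Proof. by move=> fg; apply: linear_ext; apply: free_ext. Qed.

Definition J_val a (u : U a) (f : J_rep a) : k^o :=
  (f : {linear {freeg (U a) / k} -> k^o}) (fbasis u).

Lemma J_val_linear a (u : U a) : linear (J_val u).
Proof. by []. Qed.

Lemma J_val_act al (u : U (target al)) (f : J_rep (source al)) :
  J_val u (act J_rep al f) = J_val (cns u) f.
Proof. by rewrite /J_val /= free_mapE. Qed.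

Section HomToJ.
Variables (M : rep k Q) (phi : forall a, U a -> {linear M a -> k^o}).
Hypothesis phi_cns : forall al (u : U (target al)) (x : M (source al)),
  phi (cns u) x = phi u (act M al x).

Definition J_lift_fun a (x : M a) : J_rep a := free_lift (fun u => phi u x).

Lemma J_lift_funE a (x : M a) u : J_val u (J_lift_fun x) = phi u x.
Proof. exact: free_liftE. Qed.

Lemma J_lift_linear a : linear (@J_lift_fun a).
Proof.
move=> c x y; apply: J_ext => u.
by rewrite -!/(J_val _ _) J_val_linear !J_lift_funE linearP.
Qed.

Lemma J_lift_natural al (x : M (source al)) :
  mk_linear (@J_lift_linear (target al)) (act M al x)
  = act J_rep al (mk_linear (@J_lift_linear (source al)) x).
Proof.
rewrite !mk_linearE; apply: J_ext => u.
by rewrite -!/(J_val _ _) J_val_act !J_lift_funE phi_cns.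
Qed.

(** Homomorphisms into a dual representation are built from families of functionals compatible with
    prefixing an arrow. *)
Definition J_lift : rep_hom M J_rep :=
  @Defs.Hom k Q M J_rep (fun a => mk_linear (@J_lift_linear a)) J_lift_natural.

Lemma J_liftE a (x : M a) u : J_val u (J_lift a x) = phi u x.
Proof. by rewrite /= mk_linearE J_lift_funE. Qed.
End HomToJ.
End DualRep.

(** * Epimorphisms and pointwise surjectivity *)

Section Epi.
Variables (k : fieldType) (Q : quiver).

Lemma pointwise_surj_epi (M N : rep k Q) (f : rep_hom M N) :
  (forall a y, exists x, f a x = y) -> epi f.
Proof. by move=> fs L g h gh a y; have [x <-] := fs a y; apply: gh. Qed.

(** If [f a] missed [y], a functional that vanishes on its image and is 1 at [y], composed with the
    action along paths ending at [a], would give a nonzero homomorphism from [N] to [I_a] whose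
    composite with [f] is zero. *)
Lemma epi_pointwise_surj (M N : rep k Q) (f : rep_hom M N) : epi f ->
  forall a y, exists x, f a x = y.
Proof.
move=> fepi a y; apply: contrapT => nfy.
have [||phi phif phiy] :=
    @exists_functional k (N a) [set z | exists x, f a x = z] y _ _ nfy.
- by exists 0; rewrite linear0.
- by move=> c u v [x <-] [x' <-]; exists (c *: x + x'); rewrite linearP.
pose phis b (q : qpath b a) : {linear N b -> k^o} := phi \o pact N (val q) b a.
have phisP al (u : qpath (target al) a) (x : N (source al)) :
    phis _ (path_before u) x = phis _ u (act N al x).
  by rewrite /phis /comp /= castv_id.
have gf0 : hom_eq (hom_comp (J_lift phisP) f) (hom_comp (zero_hom _ _) f).
  move=> b x; apply: J_ext => u.
  rewrite -!/(J_val _ _) /= (J_liftE phisP) /phis /= -hom_pact phif //.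
  by exists (pact M (val u) b a x).
have /(congr1 (J_val (trivial_path a))) := fepi _ _ _ gf0 a y.
rewrite (J_liftE phisP) /phis /= castv_id phiy => /eqP.
by rewrite oner_eq0.
Qed.
End Epi.

(** * Biproducts, kernels and retracts *)

Section Sums.
Variables (k : fieldType) (Q : quiver).
Implicit Types (L M N : rep k Q).

Lemma mk_hom_natural M N (f : forall a, M a -> N a)
    (flin : forall a, linear (f a))
    (fnat : forall al x, f (target al) (act M al x) = act N al (f (source al) x)) al x :
  mk_linear (flin (target al)) (act M al x)
  = act N al (mk_linear (flin (source al)) x).
Proof. by rewrite !mk_linearE fnat. Qed.

Definition mk_hom M N f flin fnat : rep_hom M N :=
  @Defs.Hom k Q M N (fun a => mk_linear (flin a))
    (@mk_hom_natural M N f flin fnat).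

Lemma mk_homE M N f flin fnat a x : @mk_hom M N f flin fnat a x = f a x.
Proof. exact: mk_linearE. Qed.

Lemma hom_compE L M N (g : rep_hom M N) (f : rep_hom L M) a x :
  hom_comp g f a x = g a (f a x).
Proof. by []. Qed.

Section Biproduct.
Variables M N : rep k Q.

Lemma inl_linear a : linear (fun x : M a => (x, 0) : oplus M N a).
Proof. by move=> c x y; apply: injective_projections; rewrite /= ?scaler0 ?addr0. Qed.

Lemma inl_natural al (x : M (source al)) :
  ((act M al x, 0) : oplus M N (target al)) = act (oplus M N) al (x, 0).
Proof. by apply: injective_projections; rewrite /= ?linear0. Qed.

Definition oplus_inl : rep_hom M (oplus M N) := mk_hom inl_linear inl_natural.

Lemma oplus_inlE a (x : M a) : oplus_inl a x = (x, 0).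
Proof. exact: mk_homE. Qed.

Lemma inr_linear a : linear (fun x : N a => (0, x) : oplus M N a).
Proof. by move=> c x y; apply: injective_projections; rewrite /= ?scaler0 ?addr0. Qed.

Lemma inr_natural al (x : N (source al)) :
  ((0, act N al x) : oplus M N (target al)) = act (oplus M N) al (0, x).
Proof. by apply: injective_projections; rewrite /= ?linear0. Qed.

Definition oplus_inr : rep_hom N (oplus M N) := mk_hom inr_linear inr_natural.

Lemma oplus_inrE a (x : N a) : oplus_inr a x = (0, x).
Proof. exact: mk_homE. Qed.

Lemma oplus_split a (x : oplus M N a) :
  x = oplus_inl a x.1 + oplus_inr a x.2.
Proof.
rewrite oplus_inlE oplus_inrE.
by apply: injective_projections; rewrite /= ?addr0 ?add0r.
Qed.

Section Copair.
Variables (L : rep k Q) (f : rep_hom M L) (g : rep_hom N L).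

Lemma copair_linear a : linear (fun x : oplus M N a => f a x.1 + g a x.2).
Proof. by move=> c x y; rewrite !linearP /= scalerDr addrACA. Qed.

Lemma copair_natural al (x : oplus M N (source al)) :
  f _ (act (oplus M N) al x).1 + g _ (act (oplus M N) al x).2
  = act L al (f _ x.1 + g _ x.2).
Proof. by rewrite /= !hom_natural linearD. Qed.

Definition copair : rep_hom (oplus M N) L := mk_hom copair_linear copair_natural.

Lemma copairE a (x : oplus M N a) : copair a x = f a x.1 + g a x.2.
Proof. exact: mk_homE. Qed.
End Copair.

Section Pair.
Variables (L : rep k Q) (f : rep_hom L M) (g : rep_hom L N).

Lemma pair_hom_linear a : linear (fun x : L a => (f a x, g a x) : oplus M N a).
Proof. by move=> c x y; rewrite !linearP. Qed.

Lemma pair_hom_natural al (x : L (source al)) :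
  ((f _ (act L al x), g _ (act L al x)) : oplus M N (target al))
  = act (oplus M N) al (f _ x, g _ x).
Proof. by rewrite !hom_natural. Qed.

Definition pair_hom : rep_hom L (oplus M N) :=
  mk_hom pair_hom_linear pair_hom_natural.

Lemma pair_homE a (x : L a) : pair_hom a x = (f a x, g a x).
Proof. exact: mk_homE. Qed.
End Pair.
End Biproduct.

Section KernelHoms.
Variables (M N : rep k Q) (f : rep_hom M N).

Lemma ker_spaceP a (x : ker_space (f a)) : f a (val x) = 0.
Proof. by have := valP x; rewrite unfold_in => /eqP. Qed.

Lemma ker_val_linear a : linear (fun x : ker_rep f a => ker_val x).
Proof. by []. Qed.

Definition ker_incl : rep_hom (ker_rep f) M :=
  @mk_hom (ker_rep f) M _ ker_val_linear (fun al x => erefl).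

Lemma ker_inclE a (x : ker_rep f a) : ker_incl a x = ker_val x.
Proof. exact: mk_homE. Qed.

Lemma ker_incl_inj a : injective (ker_incl a).
Proof. by move=> x y; rewrite !ker_inclE => /val_inj. Qed.

Lemma hom_ker_incl a (x : ker_rep f a) : f a (ker_incl a x) = 0.
Proof. by rewrite ker_inclE ker_spaceP. Qed.

Lemma ker_incl_surj a (x : M a) : f a x = 0 -> exists y, ker_incl a y = x.
Proof.
move=> fx; have xK : x \in in_ker (f a) by rewrite unfold_in fx.
by exists (KerSpace xK); rewrite ker_inclE.
Qed.

Section Lift.
Variables (L : rep k Q) (g : rep_hom L M).
Hypothesis fg0 : forall a x, f a (g a x) = 0.

Lemma ker_lift_subproof a (x : L a) : g a x \in in_ker (f a).
Proof. by rewrite unfold_in fg0. Qed.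

Let lift a (x : L a) : ker_rep f a := KerSpace (ker_lift_subproof x).

Lemma ker_lift_linear a : linear (@lift a).
Proof. by move=> c x y; apply: val_inj; rewrite /= linearP. Qed.

Lemma ker_lift_natural al (x : L (source al)) :
  lift (act L al x) = act (ker_rep f) al (lift x).
Proof. by apply: val_inj; rewrite /= hom_natural. Qed.

Definition ker_lift : rep_hom L (ker_rep f) :=
  mk_hom ker_lift_linear ker_lift_natural.

Lemma ker_liftE a x : ker_incl a (ker_lift a x) = g a x.
Proof. by rewrite ker_inclE mk_homE. Qed.
End Lift.
End KernelHoms.

Lemma rep0_eq0 a (x : rep0 k Q a) : x = 0.
Proof. exact: thinmx0. Qed.

Lemma P_sum_projective s M N (f : rep_hom M N) (h : rep_hom (P_sum k s) N) :
  (forall a y, exists x, f a x = y) ->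
  exists T : rep_hom (P_sum k s) M, hom_eq (hom_comp f T) h.
Proof.
move=> fsurj; elim: s h => [|a s IHs] h.
  by exists (zero_hom _ _) => a x; rewrite /= (rep0_eq0 x) !linear0.
have [T TP] := IHs (hom_comp h (oplus_inr (P_rep k a) (P_sum k s))).
have [m mP] := fsurj a
  (h a (oplus_inl (P_rep k a) (P_sum k s) a (fbasis (trivial_path a)))).
exists (copair (P_lift m) T) => b x.
rewrite hom_compE copairE linearD [in RHS](oplus_split x) linearD.
congr (_ + _); last exact: TP.
apply: (P_hom_ext (f := hom_comp f (P_lift m)) (g := hom_comp h (oplus_inl _ _))).
by rewrite /= P_lift_trivial mP.
Qed.

(** Serves to generate a kernel by two finite families at once. *)
Lemma P_sum_cat s s' M (f : rep_hom (P_sum k s) M) (g : rep_hom (P_sum k s') M) :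
  exists h : rep_hom (P_sum k (s ++ s')) M,
    forall a x y, exists z, h a z = f a x + g a y.
Proof.
elim: s f => [|b s IHs] f.
  by exists g => a x y; exists y; rewrite (rep0_eq0 x) linear0 add0r.
have [h hP] := IHs (hom_comp f (oplus_inr (P_rep k b) (P_sum k s))).
exists (copair (hom_comp f (oplus_inl _ _)) h) => a x y.
have [z hz] := hP a x.2 y; exists (x.1, z).
by rewrite copairE hom_compE hz addrA [in RHS](oplus_split x) linearD.
Qed.

Lemma finitely_presented_retract M N (i : rep_hom N M) (r : rep_hom M N) :
  hom_eq (hom_comp r i) (hom_id N) ->
  finitely_presented M -> finitely_presented N.
Proof.
move=> ri [s [f [/epi_pointwise_surj fsurj [s' [g /epi_pointwise_surj gsurj]]]]].
have rf_surj a y : exists x, hom_comp r f a x = y.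
  by have [x fx] := fsurj a (i a y); exists x; rewrite /= fx; apply: ri.
exists s, (hom_comp r f); split; first exact: (pointwise_surj_epi rf_surj).
(* Modulo [ker f], an element of [ker (r f)] is its own image under a lift [T]
   to [P_sum s] of the endomorphism [1 - i r]. *)
have [T TP] := P_sum_projective (sub_hom f (hom_comp i (hom_comp r f))) fsurj.
have rfT a x : hom_comp r f a (T a x) = 0.
  have := TP a x; rewrite /= => ->; rewrite linearB /=.
  by have := ri a (r a (f a x)); rewrite /= => ->; rewrite subrr.
have rfK a x : hom_comp r f a (hom_comp (ker_incl f) g a x) = 0.
  by rewrite /= hom_ker_incl linear0.
have [h hP] := P_sum_cat (ker_lift rfT) (ker_lift rfK).
exists (s ++ s'), h; apply: pointwise_surj_epi => a y.
pose z := ker_incl _ a y.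
have rfz : r a (f a z) = 0 by have := hom_ker_incl y.
(* Since [f (T z) = f z] when [r (f z) = 0], the rest [z - T z] is a relation of [M]. *)
have [t tz] : exists t, ker_incl f a t = z - T a z.
  apply: ker_incl_surj; rewrite linearB.
  by have := TP a z; rewrite /= => ->; rewrite rfz linear0 subr0 subrr.
have [w gw] := gsurj a t.
have [x hx] := hP a z w; exists x; rewrite hx.
apply: ker_incl_inj; rewrite linearD !ker_liftE /= gw tz.
by rewrite addrC subrK.
Qed.

Lemma P_sum_finitely_presented (s : seq (vertex Q)) : finitely_presented (P_sum k s).
Proof.
exists s, (hom_id _); split; first by apply: pointwise_surj_epi => a y; exists y.
exists [::], (zero_hom _ _); apply: pointwise_surj_epi => a y; exists 0.
by apply: ker_incl_inj; rewrite !linear0; have := hom_ker_incl y.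
Qed.

Lemma P_finitely_presented (a : vertex Q) : finitely_presented (P_rep k a).
Proof.
apply: (@finitely_presented_retract (P_sum k [:: a]) _ (oplus_inl _ (rep0 k Q))
  (copair (hom_id _) (zero_hom _ _)) _ (P_sum_finitely_presented [:: a])).
by move=> b x; rewrite hom_compE copairE oplus_inlE /= addr0.
Qed.

Lemma P_sum_supp (s : seq (vertex Q)) c : supp (P_sum k s) c ->
  exists2 a, a \in s & predecessors c a.
Proof.
case=> x; apply: contra_notP => noP; elim: s x noP => [|a s IHs] x noP.
  exact: rep0_eq0.
rewrite (oplus_split x) (IHs x.2) => [|[b bs bc]]; last first.
  by apply: noP; exists b; rewrite // inE bs orbT.
rewrite linear0 addr0.
suff -> : x.1 = 0 by rewrite linear0.
apply: (free_ext (f := idfun) (g := \0)) => q; exfalso.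
by apply: noP; exists a; [rewrite inE eqxx | exists q].
Qed.

Lemma finitely_generated_supp M : finitely_generated M ->
  exists s : seq (vertex Q), forall c, supp M c ->
    exists2 a, a \in s & predecessors c a.
Proof.
move=> [s [f /epi_pointwise_surj fsurj]]; exists s => c [y y0]; apply: P_sum_supp.
have [x fx] := fsurj c y; exists x => x0; apply: y0.
by rewrite -fx x0 linear0.
Qed.

End Sums.

(** * Division of paths by arrows *)

Section Division.
Variables (k : fieldType) (Q : quiver).
Implicit Types (M N : rep k Q) (a b c d : vertex Q) (al be : arrow Q).

(** Such maps strip a last arrow [al] and annihilate what ends in another arrow. They are given at
    every vertex because [be] may have any target. *)
Definition right_division al N (del : forall c, {linear N c -> N (source al)}) :=
  (forall y, del _ (act N al y) = y) /\
  (forall be y, be != al -> del _ (act N be y) = 0).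

(** On a path ending in [al] the [insub] succeeds; it only supplies the proof that the shortened
    list is a path. *)
Definition drop_last al a c (q : qpath a c) : {freeg (qpath a (source al)) / k} :=
  if rev (val q) is be :: w then
    if be == al then
      if (insub (rev w) : option (qpath a (source al))) is Some q'
      then fbasis q' else 0
    else 0
  else 0.

Definition P_rdiv al a c : {linear P_rep k a c -> P_rep k a (source al)} :=
  free_lift (@drop_last al a c).

Lemma P_right_division al a : right_division (P_rdiv al a).
Proof.
split=> [y|be y beal].
  apply: (free_ext (f := P_rdiv al a _ \o act (P_rep k a) al) (g := idfun)) => p /=.
  rewrite free_mapE free_liftE /drop_last rev_rcons eqxx revK.
  by rewrite insubT ?(valP p) // => h; congr (fbasis _); apply: val_inj.
apply: (free_ext (f := P_rdiv al a _ \o act (P_rep k a) be) (g := \0)) => p /=.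
by rewrite free_mapE free_liftE /drop_last rev_rcons (negPf beal).
Qed.

Lemma P_sum_right_division al (s : seq (vertex Q)) :
  exists del, @right_division al (P_sum k s) del.
Proof.
elim: s => [|a s [del [del1 del2]]].
  exists (fun=> \0); split=> [y|//].
  by rewrite (rep0_eq0 y) linear0.
pose D c (x : P_sum k (a :: s) c) : P_sum k (a :: s) (source al) :=
  (P_rdiv al a c x.1, del c x.2).
have Dlin c : linear (@D c) by move=> e x y; rewrite /D !linearP.
have [P1 P2] := P_right_division al a.
exists (fun c => mk_linear (Dlin c)); split=> [[y1 y2]|be [y1 y2] beal].
  by rewrite mk_linearE /D P1 del1.
by rewrite mk_linearE /D P2 // del2.
Qed.

(** At [c != a] every basis path of [P_rep k a] is nontrivial, so it ends in an arrow, and [G]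
    commutes with the action of that arrow. *)
Lemma P_hom_rdiv al N del a c (G : rep_hom (P_rep k a) N) (x : P_rep k a c) :
  right_division del -> c != a ->
  del c (G c x) = G (source al) (P_rdiv al a c x).
Proof.
move=> [del1 del2] ca; have [P1 P2] := P_right_division al a.
apply: (free_ext (f := del c \o G c) (g := G _ \o P_rdiv al a c)) => -[w wP] /=.
case/lastP: w wP => [|w be] wP; first by case/eqP: ca; rewrite (eqP wP).
have [wa bec] := is_path_rconsE wP; subst c.
pose p : qpath a (source be) := exist _ w wa.
have -> : fbasis (exist _ (rcons w be) wP : qpath a (target be))
    = act (P_rep k a) be (fbasis p) :> {freeg _ / k}.
  by rewrite /= free_mapE; congr (fbasis _); apply: val_inj.
rewrite hom_natural; have [beal|beal] := eqVneq be al.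
  by subst be; rewrite del1 P1.
by rewrite del2 // P2 // linear0.
Qed.

Lemma P_sum_hom_rdiv al N del (s : seq (vertex Q)) c (G : rep_hom (P_sum k s) N)
    (x : P_sum k s c) :
  right_division del -> c \notin s ->
  exists y, del c (G c x) = G (source al) y.
Proof.
move=> delP; elim: s G x => [|a s IHs] G x.
  by exists 0; rewrite (rep0_eq0 x) !linear0.
rewrite inE negb_or => /andP[ca cs].
have [y yP] := IHs (hom_comp G (oplus_inr _ _)) x.2 cs.
exists (oplus_inl _ _ _ (P_rdiv al a c x.1) + oplus_inr _ _ _ y).
rewrite [in LHS](oplus_split x) !linearD; congr (_ + _); last exact: yP.
exact: (P_hom_rdiv (hom_comp G (oplus_inl _ _))).
Qed.

(* If the kernel of [P_0 -> M] is generated at the vertices in [V], dividing a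
   relation [al y = 0] with target outside [V] by [al] yields [y = 0]. *)
Lemma finitely_presented_act_inj M : finitely_presented M ->
  exists V : seq (vertex Q), forall al, target al \notin V ->
    forall z, act M al z = 0 -> z = 0.
Proof.
move=> [s [f [/epi_pointwise_surj fsurj [s' [g /epi_pointwise_surj gsurj]]]]].
exists s' => al alV z alz.
have [y fy] := fsurj _ z.
have [t tE] : exists t, ker_incl f (target al) t = act _ al y.
  by apply: ker_incl_surj; rewrite hom_natural fy.
have [w gw] := gsurj _ t.
have [del delP] := P_sum_right_division al s.
have [u uP] := P_sum_hom_rdiv (hom_comp (ker_incl f) g) w delP alV.
move: uP; rewrite !hom_compE gw tE delP.1 => yE.
by rewrite -fy yE hom_ker_incl.
Qed.

Definition drop_first be c d (q : qpath c d) : {freeg (qpath (target be) d) / k} :=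
  if val q is al :: w then
    if al == be then
      if (insub w : option (qpath (target be) d)) is Some q'
      then fbasis q' else 0
    else 0
  else 0.

(** For [c = source be], a left inverse of precomposition with [be], the embedding of
    [P_(target be)] into [P_(source be)]. *)
Definition P_ldiv be c d : {linear P_rep k c d -> P_rep k (target be) d} :=
  free_lift (@drop_first be c d).

Lemma P_lift_path_before al d (q : qpath (target al) d) :
  P_lift (act (P_rep k (source al)) al (fbasis (trivial_path (source al)))) d
    (fbasis q) = fbasis (path_before q).
Proof. by rewrite P_liftE -pact_cons (pact_P k (path_before q)). Qed.

Lemma P_ldiv_lift al d (x : P_rep k (target al) d) :
  P_ldiv al (source al) d
    (P_lift (act (P_rep k (source al)) al (fbasis (trivial_path (source al)))) d x)
  = x.
Proof.
move: (P_lift _) (@P_lift_path_before al d) => io ioE.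
apply: (free_ext (f := P_ldiv al (source al) d \o io d) (g := idfun)) => q.
rewrite [LHS]/= ioE free_liftE /drop_first /= eqxx.
by rewrite insubT ?(valP q) // => h; congr (fbasis _); apply: val_inj.
Qed.

Lemma P_ldiv_lift0 al be d (x : P_rep k (target al) d) : al != be ->
  P_ldiv be (source al) d
    (P_lift (act (P_rep k (source al)) al (fbasis (trivial_path (source al)))) d x)
  = 0.
Proof.
move: (P_lift _) (@P_lift_path_before al d) => io ioE albe.
apply: (free_ext (f := P_ldiv be (source al) d \o io d) (g := \0)) => q.
by rewrite [LHS]/= ioE free_liftE /drop_first /= (negPf albe).
Qed.

(** The map [f] is precomposition with the arrows of [l]. Division by each arrow separates the
    summands, whence injectivity; the middle clause carries the induction. In the last clause [g]
    sends the generator belonging to [al] to [v al], and [pact] absorbs the equality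
    [source al = c]. *)
Lemma arrows_hom c (l : seq (arrow Q)) : uniq l ->
  (forall al, al \in l -> source al = c) ->
  exists f : rep_hom (P_sum k (map (@target Q) l)) (P_rep k c),
  [/\ forall d x, f d x = 0 -> x = 0,
      forall be d x, be \notin l -> P_ldiv be c d (f d x) = 0 &
      forall M (v : forall be, M (target be)),
        exists g : rep_hom (P_sum k (map (@target Q) l)) M,
        forall h : rep_hom (P_rep k c) M, hom_eq (hom_comp h f) g ->
        forall al, al \in l ->
          pact M [:: al] c (target al) (h c (fbasis (trivial_path c))) = v al].
Proof.
elim: l => [|al l IHl] /=.
  move=> _ _; exists (zero_hom _ _); split=> [d x _|be d x _|M v].
  - exact: (@rep0_eq0 k Q d x).
  - by rewrite linear0.
  - by exists (zero_hom _ _).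
move=> /andP[all lU] lc; have alc : source al = c by apply: lc; rewrite mem_head.
have [||f [finj fdiv fM]] := IHl => // [be bel|].
  by apply: lc; rewrite inE bel orbT.
subst c; set e := fbasis (trivial_path (source al)).
pose io := P_lift (act (P_rep k (source al)) al e).
exists (copair io f); split.
- move=> d x; rewrite copairE => x0.
  have := congr1 (P_ldiv al (source al) d) x0.
  rewrite linear0 linearD fdiv // addr0 P_ldiv_lift => x1.
  move: x0; rewrite x1 linear0 add0r => /finj x2.
  by case: (x) x1 x2 => ? ? /= -> ->.
- move=> be d x; rewrite inE negb_or => /andP[beal bel].
  by rewrite copairE linearD fdiv // addr0 P_ldiv_lift0 // eq_sym.
- move=> M v; have [g gP] := fM M v.
  exists (copair (P_lift (v al)) g) => h hP be; rewrite inE => /orP[/eqP->|].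
    have := hP _ (oplus_inl (P_rep k (target al)) (P_sum k (map (@target Q) l))
      _ (fbasis (trivial_path (target al)))).
    rewrite hom_compE !copairE oplus_inlE !linear0 !addr0 !P_lift_trivial.
    by rewrite hom_natural /= !castv_id.
  apply: gP => d x; have := hP d (oplus_inr (P_rep k (target al)) _ _ x).
  by rewrite !hom_compE !copairE oplus_inrE !linear0 !add0r.
Qed.

(** Injectivity extends the map prescribing [v] on the summands to all of [P_rep k c]; [z] is the
    image of the trivial path. *)
Lemma injective_arrows_surj (I : rep k Q) :
  injective_in (@finitely_presented k Q) I ->
  forall c (l : seq (arrow Q)), uniq l -> (forall al, al \in l -> source al = c) ->
  forall v : forall be, I (target be), exists z : I c, forall al, al \in l ->
    pact I [:: al] c (target al) z = v al.
Proof.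
move=> [_ Iinj] c l lU lc v.
have [f [finj _ fI]] := arrows_hom lU lc; have [g gP] := fI I v.
have [|h hP] := Iinj _ _ f (P_sum_finitely_presented _ _)
  (P_finitely_presented _ _) _ g.
  move=> L h h' _ hh' a x; apply/eqP; rewrite -subr_eq0; apply/eqP.
  by apply: finj; rewrite linearB; apply/eqP; rewrite subr_eq0; apply/eqP; apply: hh'.
by exists (h c (fbasis (trivial_path c))) => al; apply: gP.
Qed.

End Division.

(** * Splitting off a dual representation *)

Lemma existT_inj (T : eqType) (U : T -> Type) a (u v : U a) :
  existT U a u = existT U a v -> u = v.
Proof. exact: (Eqdep_dec.inj_pair2_eq_dec _ (@eq_comparable T)). Qed.

Section Splitting.
Variables (k : fieldType) (Q : quiver) (I : rep k Q).
Variables (U : vertex Q -> choiceType).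
Variable cns : forall al : arrow Q, U (target al) -> U (source al).
Hypothesis cns_inj : forall al, injective (@cns al).

Section Retract.
Variable phi : forall a, U a -> {linear I a -> k^o}.
Variable Y : forall a, U a -> I a.
Variable enumU : forall a, seq (U a).
Hypothesis phi_cns : forall al (u : U (target al)) (x : I (source al)),
  phi (cns u) x = phi u (act I al x).
Hypothesis act_Y : forall al (u : U (target al)), act I al (Y (cns u)) = Y u.
Hypothesis act_Y0 : forall al (u : U (source al)),
  (forall v : U (target al), u <> cns v) -> act I al (Y u) = 0.
Hypothesis phi_Y : forall a (u v : U a), phi u (Y v) = (u == v)%:R.
Hypothesis enumU_uniq : forall a, uniq (enumU a).
Hypothesis mem_enumU : forall a (u : U a), u \in enumU a.

Let J := J_rep k cns.
Let g : rep_hom I J := J_lift phi_cns.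

(** As [U a] is finite, an element of the dual is a finite combination of the dual basis, which [Y]
    realizes inside [I]. *)
Definition J_section_fun a (f : J a) : I a :=
  \sum_(u <- enumU a) (J_val u f : k) *: Y u.

Lemma J_section_linear a : linear (@J_section_fun a).
Proof.
move=> c f f'; rewrite /J_section_fun scaler_sumr -big_split /=.
by apply: eq_bigr => u _; rewrite scalerA -scalerDl.
Qed.

(** [act I al] sends [Y (cns v)] to [Y v] and kills every other [Y u], so only the indices in the
    image of the injective map [cns] survive. *)
Lemma J_section_natural al (f : J (source al)) :
  J_section_fun (act J al f) = act I al (J_section_fun f).
Proof.
rewrite /J_section_fun linear_sum.
rewrite [RHS](bigID (mem (map (@cns al) (enumU (target al))))) /=.
rewrite [X in _ = _ + X]big1 ?addr0 => [|u uN]; last first.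
  rewrite linearZ /= act_Y0 ?scaler0 // => v uv; case/negP: uN.
  by rewrite uv map_f ?mem_enumU.
rewrite -[RHS]big_filter.
rewrite [RHS](perm_big (map (@cns al) (enumU (target al)))) /=; last first.
  apply: uniq_perm => [||u].
  - by apply: filter_uniq; apply: enumU_uniq.
  - by rewrite (map_inj_uniq (@cns_inj al)) enumU_uniq.
  - by rewrite mem_filter mem_enumU andbT.
by rewrite big_map; apply: eq_bigr => u _; rewrite linearZ /= act_Y free_mapE.
Qed.

Definition J_section : rep_hom J I := mk_hom J_section_linear J_section_natural.

Lemma J_sectionK : hom_eq (hom_comp g J_section) (hom_id J).
Proof.
move=> a f; apply: J_ext => u; rewrite -!/(J_val _ _) hom_compE J_liftE.
rewrite mk_homE /J_section_fun linear_sum /= (bigD1_seq u) //= linearZ phi_Y.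
rewrite eqxx big1 ?addr0 => [|v vu]; first exact: mulr1.
by rewrite linearZ /= phi_Y eq_sym (negPf vu) scaler0.
Qed.

Let e : rep_hom I I := sub_hom (hom_id I) (hom_comp J_section g).

Lemma J_complement a x : g a (e a x) = 0.
Proof.
rewrite linearB; apply/eqP; rewrite subr_eq0; apply/eqP.
by have := J_sectionK (g a x).
Qed.

(** [I] is the direct sum of [J] and the kernel of [g], both finitely presented as retracts. [J] is
    nonzero because [phi u0] is 1 at [Y u0], so the kernel vanishes. *)
Lemma indecomposable_iso_J : (exists a, inhabited (U a)) ->
  indecomposable_in (@finitely_presented k Q) I -> rep_iso I J.
Proof.
move=> [a0 [u0]] [fpI _ Iind].
have eE a x : e a x = x - J_section a (g a x) by [].
have incl_e a x : ker_incl g a (ker_lift J_complement a x) = e a x.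
  exact: ker_liftE.
have split_e a x : J_section a (g a x) + e a x = x.
  by rewrite eE addrC subrK.
have fpJ : finitely_presented J := finitely_presented_retract J_sectionK fpI.
have fpK : finitely_presented (ker_rep g).
  apply: (@finitely_presented_retract _ _ _ _ (ker_incl g) (ker_lift J_complement)) fpI.
  move=> a x; apply: ker_incl_inj; rewrite hom_compE incl_e.
  by rewrite eE hom_ker_incl linear0 subr0.
have [|J0|K0] := Iind _ _ fpJ fpK.
- exists (pair_hom g (ker_lift J_complement)), (copair J_section (ker_incl g)).
  split=> a x.
    by rewrite hom_compE pair_homE copairE incl_e split_e.
  have gx : g a (copair J_section (ker_incl g) a x) = x.1.
    rewrite copairE linearD hom_ker_incl addr0.
    by have := J_sectionK x.1.
  rewrite hom_compE pair_homE gx; apply: injective_projections => //.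
  apply: ker_incl_inj; rewrite incl_e eE gx copairE.
  by rewrite addrAC subrr add0r.
- have := congr1 (J_val u0) (J0 a0 (g a0 (Y u0))).
  by rewrite J_liftE phi_Y eqxx => /eqP; rewrite oner_eq0.
exists g, J_section; split=> a x; last exact: J_sectionK.
rewrite [RHS](_ : _ = x) // -[RHS](split_e a x) -incl_e.
by rewrite (K0 _ (ker_lift _ _ _)) linear0 addr0.
Qed.
End Retract.

(** * Construction of the dual family by recursion on a rank *)

Section DualFamily.
Variable rk : forall a, U a -> nat.
Variable X : forall a, U a -> I a.
Hypothesis rk_cns0 : forall al (v : U (target al)), rk (cns v) = 0%N -> rk v = 0%N.
Hypothesis rk_cnsS : forall al (v : U (target al)), rk (cns v) <> 0%N ->
  rk (cns v) = (rk v).+1.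
Hypothesis act_X : forall al (v : U (target al)), rk (cns v) = 0%N ->
  act I al (X (cns v)) = X v.
Hypothesis act_X0 : forall al (u : U (source al)), rk u = 0%N ->
  (forall v : U (target al), u <> cns v) -> act I al (X u) = 0.
Hypothesis arrows_surj : forall v : forall be, I (target be),
  exists z : forall a, I a, forall be, act I be (z (source be)) = v be.

(** [rk u] counts the arrows to strip from [u] before reaching a base element, whose value is
    prescribed by [X]. Recursion on it uses [arrows_surj] to lift the values already built,
    simultaneously along all arrows. *)
Lemma exists_dual_family : exists Y : forall a, U a -> I a,
  [/\ forall a (u : U a), rk u = 0%N -> Y a u = X u,
      forall al (u : U (target al)), act I al (Y _ (cns u)) = Y _ u &
      forall al (u : U (source al)),
        (forall v : U (target al), u <> cns v) -> act I al (Y _ u) = 0].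
Proof.
have [z zP] := choice arrows_surj.
(* Dependent pairs are compared because [u] and [cns v] may live over different vertices. *)
pose isc a (u : U a) be (v : U (target be)) :=
  existT (fun a => U a : Type) a u = existT _ (source be) (cns v).
(* The images required of the element for [u]: along [be] it must go to the element for [v] if [u]
   is [v] prefixed by [be], and to 0 otherwise. Such a [v] is unique since [cns] is injective. *)
pose tails (Yn : forall a, U a -> I a) a (u : U a) be : I (target be) :=
  if pselect (exists v, isc a u be v) is left h then Yn _ (projT1 (cid h)) else 0.
pose Yn := fix Yn n a (u : U a) : I a :=
  if n is n'.+1 then z (tails (Yn n') a u) a else X u.
exists (fun a u => Yn (rk u) a u); split.
- by move=> a u ->.
- move=> al u; have [r0|r0] := pselect (rk (cns u) = 0%N).
    by rewrite r0 /= act_X // rk_cns0.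
  rewrite rk_cnsS //= zP /tails; case: pselect => [h|[]]; last by exists u.
  case: cid => v /= uv; congr (Yn _ _ _); apply: esym; exact: (cns_inj (existT_inj uv)).
- move=> al u uN; case ru : (rk u) => [|n] /=; first exact: act_X0.
  rewrite zP /tails; case: pselect => // h; exfalso.
  by case: h => v uv; apply: (uN v); apply: (existT_inj uv).
Qed.

(** For [u = cns u'], compatibility of [phi] moves the arrow onto [Y v], which becomes [Y v'] if
    [v = cns v'] and 0 otherwise; the rank of [u'] is smaller. *)
Lemma dual_family_biorthogonal (phi : forall a, U a -> {linear I a -> k^o})
    (Y : forall a, U a -> I a) :
  (forall al (u : U (target al)) (x : I (source al)),
    phi _ (cns u) x = phi _ u (act I al x)) ->
  (forall al (u : U (target al)), act I al (Y _ (cns u)) = Y _ u) ->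
  (forall al (u : U (source al)),
    (forall v : U (target al), u <> cns v) -> act I al (Y _ u) = 0) ->
  (forall a (u : U a), rk u <> 0%N -> exists al (v : U (target al)),
    existT (fun a => U a : Type) a u = existT _ (source al) (cns v)) ->
  (forall a (u v : U a), rk u = 0%N -> phi _ u (Y _ v) = (u == v)%:R) ->
  forall a (u v : U a), phi _ u (Y _ v) = (u == v)%:R.
Proof.
move=> phi_cns act_Y act_Y0 rkN base.
(* Stripping an arrow changes the vertex, so the induction runs over pairs of a vertex and an
   element. *)
suff main n (s : {a & U a}) : (rk (projT2 s) <= n)%N ->
    forall v : U (projT1 s), phi _ (projT2 s) (Y _ v) = (projT2 s == v)%:R.
  by move=> a u; apply: (main (rk u) (existT _ a u)).
elim: n s => [|n IHn] [a u] /=.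
  by rewrite leqn0 => /eqP r0 v; apply: base.
move=> run v; have [r0|r0] := pselect (rk u = 0%N); first exact: base.
have [al [u' uE]] := rkN _ _ r0.
suff {v} main v : phi _ (cns u') (Y _ v) = (cns u' == v)%:R.
  by move: v; rewrite -[a]/(projT1 (existT (fun a => U a : Type) a u))
    -[u]/(projT2 (existT (fun a => U a : Type) a u)) uE.
have rE : rk u = rk (cns u') := congr1 (fun s => rk (projT2 s)) uE.
have ru' : (rk u' <= n)%N.
  by move: run r0; rewrite rE => + /rk_cnsS r1; rewrite r1.
rewrite phi_cns; have [[v' ->]|vN] := pselect (exists v', v = cns v').
  rewrite act_Y (inj_eq (@cns_inj al)).
  exact: (IHn (existT (fun a => U a : Type) _ u') ru' v').
rewrite act_Y0 => [|v' vv']; last by apply: vN; exists v'.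
by rewrite linear0; case: eqP => // uv; case: vN; exists u'.
Qed.
End DualFamily.
End Splitting.

(** * Finiteness properties of the support *)

Section Finiteness.

Lemma injective_finType_enum (T : choiceType) (F : finType) (f : T -> F) :
  injective f -> exists2 s : seq T, uniq s & forall x, x \in s.
Proof.
move=> finj.
have fT : f @` [set: T] #= [set: T] by apply: inj_card_eq => x y _ _; apply: finj.
have : finite_set [set: T].
  move: fT; rewrite card_eq_le => /andP[_ /card_le_finite]; apply.
  exact: finite_finset.
move=> /finite_seqP[s sT]; exists (undup s); first exact: undup_uniq.
by move=> x; rewrite mem_undup; have : [set: T] x by []; rewrite sT.
Qed.

Lemma injective_card_le_I T (n : nat) (f : T -> nat) :
  injective f -> (forall x, (f x < n)%N) -> [set: T] #<= `I_n.
Proof.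
move=> finj fn.
have fT : f @` [set: T] #= [set: T] by apply: inj_card_eq => x y _ _; apply: finj.
rewrite -(card_le_eql fT).
by apply: subset_card_le => _ [x _ <-]; apply: fn.
Qed.

Lemma injective_eventually_notin (T : eqType) (f : nat -> T) (s : seq T) :
  injective f -> exists N, forall n, (N <= n)%N -> f n \notin s.
Proof.
move=> finj; elim: s => [|x s [N Ns]]; first by exists 0%N.
have [[m fm]|nofm] := pselect (exists m, f m = x).
  exists (maxn N m.+1) => n; rewrite geq_max => /andP[Nn mn].
  rewrite inE negb_or Ns // andbT -fm; apply/eqP => /finj nm.
  by rewrite nm ltnn in mn.
exists N => n Nn; rewrite inE negb_or Ns // andbT.
by apply/eqP => fn; apply: nofm; exists n.
Qed.
End Finiteness.

(** * Paths in an interval finite quiver *)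

Section IntervalFinite.
Variable Q : quiver.
Hypothesis QF : interval_finite Q.
Implicit Types (a b c : vertex Q) (al be : arrow Q) (w : seq (arrow Q)).

Lemma qpath_enum a b : exists2 s : seq (qpath a b), uniq s & forall q, q \in s.
Proof.
have /finite_seqP[s sT] := QF a b.
exists (undup s); first exact: undup_uniq.
by move=> x; rewrite mem_undup; have : [set: qpath a b] x by []; rewrite sT.
Qed.

(** The powers of a nonempty cycle at [a] have unbounded length, while finitely many paths from [a]
    to [a] have bounded length. *)
Lemma acyclic a w : is_path a w a -> w = [::].
Proof.
move=> wP; case: w wP => // al w wP; exfalso.
have [s _ sP] := qpath_enum a a.
pose pw n := flatten (nseq n (al :: w)).
have pwP n : is_path a (pw n) a.
  by elim: n => [|n IHn]; [apply: eqxx | apply: (is_path_cat wP)].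
have pw_size n : (n <= size (pw n))%N.
  elim: n => // n IHn; rewrite /pw /= size_cat ltnS.
  exact: leq_trans IHn (leq_addl _ _).
pose n := (\max_(q <- s) size (val q)).+1.
have h : (size (pw n) < n)%N.
  exact: (@leq_bigmax_seq _ s xpredT (fun q => size (val q))
    (exist (fun w => is_path a w a) _ (pwP n)) (sP _) isT).
by have := leq_trans h (pw_size n); rewrite ltnn.
Qed.

Lemma no_return al w c be : is_path (target al) w c -> be \in w ->
  source be <> source al.
Proof.
move=> wP bew beal; case/splitPr: bew wP => w1 w2 /is_path_catE[d w1P /=].
move=> /andP[/eqP bed _]; subst d.
suff : al :: w1 = [::] by [].
by apply: (@acyclic (source al)); rewrite /= eqxx /= -beal.
Qed.

Lemma path_arrows_enum (A B : seq (vertex Q)) : exists l : seq (arrow Q),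
  forall a b w, a \in A -> b \in B -> is_path a w b -> {subset w <= l}.
Proof.
have enum a b : exists l : seq (arrow Q), forall w, is_path a w b -> {subset w <= l}.
  have [s _ sP] := qpath_enum a b; exists (flatten (map val s)) => w wP al alw.
  apply/flattenP; exists w => //; apply/mapP.
  by exists (exist (fun w => is_path a w b) w wP).
have [f fP] := choice (fun ab : vertex Q * vertex Q => enum ab.1 ab.2).
exists (flatten [seq f (a, b) | a <- A, b <- B]) => a b w aA bB wP al alw.
apply/flattenP; exists (f (a, b)); first exact: (allpairs_f (fun a b => f (a, b))).
exact: fP alw.
Qed.

Lemma left_path_sub (u : left_path Q) i n :
  is_path (source (val u i)) (mkseq (fun j => val u (i + j)%N) n)
    (source (val u (i + n)%N)).
Proof.
have uP : is_left_path (val u) by apply/asboolP; exact: (valP u).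
elim: n => [|n IHn]; first by rewrite addn0 /= eqxx.
by rewrite mkseqS addnS uP; apply: is_path_rcons.
Qed.

Lemma left_path_source_inj (u : left_path Q) : injective (fun i => source (val u i)).
Proof.
move=> i j.
wlog ij : i j / (i <= j)%N => [H|] /= sij.
  by case/orP: (leq_total i j) => ij; [apply: H | apply/esym/H].
have := left_path_sub u i (j - i); rewrite subnKC // -sij => /acyclic.
move=> /(congr1 size); rewrite size_mkseq /= => /eqP; rewrite subn_eq0 => ji.
by apply/eqP; rewrite eqn_leq ij.
Qed.

End IntervalFinite.

Lemma castv_eq0 (k : fieldType) (Q : quiver) (M : rep k Q) a b (x : M a) :
  a = b -> castv M a b x = 0 -> x = 0.
Proof. by move=> ab; subst b; rewrite castv_id. Qed.

(** * Branching in the support and coding of paths *)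

Section InjectiveSupport.
Variables (k : fieldType) (Q : quiver) (I : rep k Q).
Hypothesis QF : interval_finite Q.
Implicit Types (a b c : vertex Q) (al be : arrow Q) (w : seq (arrow Q)).

Variable gen : seq (vertex Q).
Hypothesis supp_gen : forall c, supp I c -> exists2 a, a \in gen & predecessors c a.
Variable V : seq (vertex Q).
Hypothesis act_inj : forall al, target al \notin V ->
  forall z, act I al z = 0 -> z = 0.
Hypothesis out_surj : forall c (l : seq (arrow Q)), uniq l ->
  (forall al, al \in l -> source al = c) ->
  forall v : forall be, I (target be), exists z : I c, forall al, al \in l ->
    pact I [:: al] c (target al) z = v al.

Lemma act_surj al (x : I (target al)) : exists z, act I al z = x.
Proof.
have [||z /(_ al (mem_head _ _))] :=
    @out_surj (source al) [:: al] _ _ (fun be => castv I (target al) (target be) x).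
- by [].
- by move=> be; rewrite inE => /eqP->.
- by rewrite pact_cons pact_nil castv_id; exists z.
Qed.

Lemma supp_source al : supp I (target al) -> supp I (source al).
Proof.
case=> x x0; have [z zx] := act_surj x.
by exists z => z0; apply: x0; rewrite -zx z0 linear0.
Qed.

Lemma supp_path a w b : is_path a w b -> supp I b -> supp I a.
Proof.
elim: w a => [|al w IHw] a /=; first by move/eqP->.
by move=> /andP[/eqP <- /IHw h] /h/supp_source.
Qed.

(** Otherwise surjectivity onto both targets gives a [z] killed by [al] and with the same nonzero
    image under [be] as [x]; injectivity of [al] forces [z = 0]. *)
Lemma out_unique al be : source al = source be -> supp I (source al) ->
  target al \notin V -> target be \notin V -> al = be.
Proof.
move=> albe [x x0] alV beV; have [//|ne] := eqVneq al be; exfalso.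
pose y := act I be (castv I (source al) (source be) x).
have y0 : y <> 0 by move=> /(act_inj beV)/(castv_eq0 albe).
pose v ga := if ga == be then castv I (target be) (target ga) y else 0.
have [||z zP] := @out_surj (source al) [:: al; be] _ _ v.
- by rewrite /= inE ne.
- by move=> ga; rewrite !inE => /orP[] /eqP->.
have := zP al (mem_head _ _); rewrite /v (negPf ne) pact_cons pact_nil.
move=> /(act_inj alV) z0; have := zP be; rewrite !inE eqxx orbT => /(_ isT).
by rewrite z0 linear0 /v eqxx castv_id => /esym.
Qed.

(** Such an arrow is the last one of a path from [gen] to [V], and finitely many arrows occur on
    these paths. *)
Lemma branching_enum : exists E : seq (arrow Q),
  forall al, supp I (source al) -> target al \in V -> al \in E.
Proof.
have [E EP] := path_arrows_enum QF gen V; exists E => al sal alV.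
have [a agen [[w wP] _]] := supp_gen sal.
by apply: (EP a _ (rcons w al) agen alV (is_path_rcons wP)); rewrite mem_rcons mem_head.
Qed.

Variable E : seq (arrow Q).
Hypothesis branching : forall al, supp I (source al) -> target al \in V -> al \in E.

Lemma nonbranching_unique al be : source al = source be -> supp I (source al) ->
  al \notin E -> be \notin E -> al = be.
Proof.
move=> albe sal alE beE; apply: out_unique => //.
  by apply: contra alE; apply: branching.
by apply: contra beE; apply: branching; rewrite -albe.
Qed.

(** The arrows starting at [c] lie in [E], with at most one exception. *)
Lemma out_enum c : supp I c -> exists l : seq (arrow Q),
  [/\ uniq l, forall al, al \in l -> source al = c &
    forall al, source al = c -> al \in l].
Proof.
move=> sc.
have [[al0 [al0c al0E]]|noal] := pselect (exists al, source al = c /\ al \notin E).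
  exists (undup [seq al <- al0 :: E | source al == c]); split.
  - exact: undup_uniq.
  - by move=> al; rewrite mem_undup mem_filter => /andP[/eqP].
  - move=> al alc; rewrite mem_undup mem_filter alc eqxx inE.
    case: (boolP (al \in E)) => [|alE]; first by rewrite orbT.
    by rewrite (@nonbranching_unique al al0) ?eqxx ?alc.
exists (undup [seq al <- E | source al == c]); split.
- exact: undup_uniq.
- by move=> al; rewrite mem_undup mem_filter => /andP[/eqP].
- move=> al alc; rewrite mem_undup mem_filter alc eqxx /=.
  by apply: contrapT => /negP alE; apply: noal; exists al.
Qed.

(** At a vertex of the support the outgoing arrows form a finite list. Elsewhere all prescribed
    values are 0, because the support is closed under predecessors. *)
Lemma arrows_surj (v : forall be, I (target be)) :
  exists z : forall a, I a, forall be, act I be (z (source be)) = v be.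
Proof.
have zP a : exists z : I a, forall be, source be = a ->
    pact I [:: be] a (target be) z = v be.
  have [sa|sa] := pselect (supp I a).
    have [l [lU la al]] := out_enum sa.
    by have [z zP] := out_surj lU la v; exists z => be /al/zP.
  exists 0 => be bea; rewrite linear0; apply: contrapT => v0; apply: sa.
  by rewrite -bea; apply: supp_source; exists (v be) => /esym.
exists (fun a => projT1 (cid (zP a))) => be; case: cid => z /= /(_ be erefl).
by rewrite !castv_id.
Qed.

(** A predecessor [c] of [b] lies in the support, so some path from [gen] to [b] runs through [c];
    unless [c = b], it is the source of one of the finitely many arrows on such paths. *)
Lemma finite_predecessors b : supp I b -> finite_set (predecessors b).
Proof.
move=> sb; have [l lP] := path_arrows_enum QF gen [:: b].
apply: (@sub_finite_set _ _ [set` b :: map (@source Q) l]); last first.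
  by apply/finite_seqP; exists (b :: map (@source Q) l).
move=> c [[w wP] _] /=; rewrite inE.
have [a agen [[w' w'P] _]] := supp_gen (supp_path wP sb).
case: w wP => [|al w] wP; first by rewrite (eqP wP) eqxx.
apply/orP; right; apply/mapP; exists al.
  apply: (lP _ _ _ agen (mem_head _ _) (is_path_cat w'P wP)).
  by rewrite mem_cat mem_head orbT.
by case/andP: wP => /eqP.
Qed.

Lemma finite_out_vertices c : supp I c -> finite_set (out_vertices c).
Proof.
move=> /out_enum[l [_ _ lP]].
apply: (@sub_finite_set _ _ [set` map (@target Q) l]); last first.
  by apply/finite_seqP; exists (map (@target Q) l).
by move=> b [al alc <-] /=; rewrite map_f ?lP.
Qed.

(** An arrow leaving the support ends in [V]: otherwise its injective action would carry a nonzero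
    element along. *)
Lemma finite_boundary :
  finite_set ((\bigcup_(a in supp I) out_vertices a) `\` supp I).
Proof.
apply: (@sub_finite_set _ _ [set` V]); last by apply/finite_seqP; exists V.
move=> b [[a [x x0] [al ala alb]] sb] /=; subst a b.
apply: contrapT => /negP alV; apply: sb.
by exists (act I al x) => /(act_inj alV).
Qed.

(** Compare first arrows. If one is in [E], it occurs in both paths, and it comes first in both
    since a path never returns to its start; two first arrows outside [E] agree by
    [nonbranching_unique]. *)
Lemma path_code_inj a b w w' : supp I b -> is_path a w b -> is_path a w' b ->
  (forall al, al \in E -> (al \in w) = (al \in w')) -> w = w'.
Proof.
move=> sb; elim: w a w' => [|al w IHw] a [|be w'] //.
- by move=> /eqP <- /(acyclic QF).
- by move=> + /eqP ab; rewrite -ab => /(acyclic QF).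
move=> wP w'P code.
have [ala wP'] := andP wP; have [bea w'P'] := andP w'P.
have albe : al = be.
  have [alE|alE] := boolP (al \in E).
    have := code _ alE; rewrite mem_head inE => /esym/orP[/eqP//|alw'].
    by case: (no_return QF w'P' alw'); rewrite (eqP ala) (eqP bea).
  have [beE|beE] := boolP (be \in E).
    have := code _ beE; rewrite mem_head inE => /orP[/eqP//|bew].
    by case: (no_return QF wP' bew); rewrite (eqP ala) (eqP bea).
  apply: nonbranching_unique => //; first by rewrite (eqP ala) (eqP bea).
  by apply: (supp_path _ sb); rewrite (eqP ala); exact: wP.
subst be; congr cons; apply: (IHw _ _ wP' w'P') => ga gaE.
have := code _ gaE; rewrite !inE; have [->|//] := eqVneq ga al => _.
have [/(no_return QF wP')//|_] := boolP (al \in w).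
by have [/(no_return QF w'P')//|_] := boolP (al \in w').
Qed.

(** As for finite paths, by induction on the position: an arrow of [E] that one path uses at the
    common vertex is used by the other, at the same position because its vertices are distinct. *)
Lemma left_path_code_inj (u v : left_path Q) :
  (forall i, supp I (source (val u i))) -> left_source u = left_source v ->
  (forall al, al \in E -> (exists i, val u i = al) <-> (exists i, val v i = al)) ->
  u = v.
Proof.
move=> su uv code; apply: val_inj; apply/funext => i.
have uP : is_left_path (val u) by apply/asboolP; exact: (valP u).
have vP : is_left_path (val v) by apply/asboolP; exact: (valP v).
have key j : source (val u j) = source (val v j) -> val u j = val v j.
  move=> suv.
  have [uE|uE] := boolP (val u j \in E).
    have [i' vi'] := (code _ uE).1 (ex_intro _ j erefl).
    rewrite -vi'; congr (val v _); apply: (left_path_source_inj QF (u := v)).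
    by rewrite /= vi'.
  have [vE|vE] := boolP (val v j \in E).
    have [i' ui'] := (code _ vE).2 (ex_intro _ j erefl).
    rewrite -ui'; congr (val u _); apply: (left_path_source_inj QF (u := u)).
    by rewrite /= ui'.
  exact: nonbranching_unique.
suff: source (val u i) = source (val v i) by apply: key.
by elim: i => // i IHi; rewrite uP vP (key _ IHi).
Qed.

(** A path from [gen] to a vertex of the support stays in the support, so it lifts to the full
    subquiver. *)
Lemma supp_top_finite : top_finite (full_subquiver (supp I)).
Proof.
pose S := full_subquiver (supp I).
exists [set a : vertex S | val a \in gen].
  apply: (@finite_preimage _ _ [set` gen] (fun a : vertex S => val a)).
    by move=> x y _ _; apply: val_inj.
  by apply/finite_seqP; exists gen.
move=> b; have sb : supp I (val b) by have := valP b; rewrite inE.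
have [a agen [[w wP] _]] := supp_gen sb.
have sa : a \in supp I by rewrite inE; apply: supp_path wP sb.
exists (exist _ a sa) => //.
suff [r rP] : exists r, @is_path S (exist _ a sa) r b.
  by exists (exist (fun r => @is_path S (exist _ a sa) r b) r rP).
elim: w a sa wP {agen} => [|al w IHw] a sa.
  by move=> /eqP ab; exists [::]; apply/eqP/val_inj.
move=> /andP[/eqP ala wP].
have ta : target al \in supp I by rewrite inE; apply: supp_path wP sb.
have [r rP] := IHw _ ta wP.
have alS : (source al \in supp I) && (target al \in supp I) by rewrite ala sa.
exists ((exist _ al alS : arrow S) :: r) => /=; apply/andP; split.
  exact/eqP/val_inj.
by congr is_path: rP; apply: val_inj.
Qed.

Lemma supp_uniformly_interval_finite :
  uniformly_interval_finite (full_subquiver (supp I)).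
Proof.
pose S := full_subquiver (supp I).
pose code (r : seq (arrow S)) := map_tuple (fun al => al \in map val r) (in_tuple E).
(* The bound counts the Boolean tuples recording which arrows of [E] a path uses. *)
exists #|{: (size E).-tuple bool}|; first by rewrite card_tuple card_bool expn_gt0.
move=> a b.
apply: (injective_card_le_I (f := fun q : qpath a b => enum_rank (code (val q)))).
  move=> q q' /ord_inj/enum_rank_inj/(congr1 val) /= /eq_in_map cqq'.
  have valP' (r : qpath a b) : is_path (val a) (map val (val r)) (val b).
    case: r => r /=; elim: r (a) => [|al r IHr] c /=; first by move=> /eqP->.
    by move=> /andP[/eqP <- /IHr] ->; rewrite eqxx.
  have sb : supp I (val b) by have := valP b; rewrite inE.
  apply/val_inj/(inj_map val_inj).
  exact: (path_code_inj sb (valP' q) (valP' q')).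
by move=> q; apply: ltn_ord.
Qed.

End InjectiveSupport.

(** * Socle elements *)

Section Socle.
Variables (k : fieldType) (Q : quiver) (I : rep k Q).
Hypothesis QF : interval_finite Q.
Hypothesis arr_surj : forall v : forall be, I (target be),
  exists z : forall a, I a, forall be, act I be (z (source be)) = v be.

(** The rank is the length of a path, and trivial paths receive the value [x]. Prefixing never
    yields a trivial path and all arrows kill [x], which settles the hypotheses at rank 0. *)
Lemma socle_iso_I_rep b (x : I b) : x <> 0 ->
  (forall al : arrow Q, act I al (castv I b (source al) x) = 0) ->
  indecomposable_in (@finitely_presented k Q) I -> rep_iso I (I_rep k b).
Proof.
move=> x0 soc Iind; have [phi0 phi0x] := functional_neq0 x0.
pose U (a : vertex Q) : choiceType := qpath a b.
pose cns (al : arrow Q) : U (target al) -> U (source al) := @path_before Q b al.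
have cns_inj al : injective (cns al).
  by move=> u v /(congr1 val) [] uv; apply: val_inj.
pose phi a (u : U a) : {linear I a -> k^o} := phi0 \o pact I (val u) a b.
have phi_cns al (u : U (target al)) (y : I (source al)) :
    phi _ (cns al u) y = phi _ u (act I al y).
  by rewrite /phi /= castv_id.
have [Y [YX act_Y act_Y0]] := @exists_dual_family k Q I U cns cns_inj
  (fun a u => size (val u)) (fun a u => castv I b a x) (fun al v => ltac:(by []))
  (fun al v _ => erefl) (fun al v => ltac:(by [])) (fun al u _ _ => soc al) arr_surj.
have phi_Y a (u v : U a) : phi a u (Y a v) = (u == v)%:R.
  apply: (dual_family_biorthogonal cns_inj (rk := fun a u => size (val u))
    _ phi_cns act_Y act_Y0) => // {a u v}.
    move=> a [[|al w] //= wP] _; have /andP[/eqP sa wP'] := wP; subst a.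
    exists al, (exist (fun w => is_path (target al) w b) w wP').
    by congr existT; apply: val_inj.
  (* Both paths are trivial: [u] by its length, then [v] by acyclicity. *)
  move=> a u v ru; have u0 : val u = [::] := size0nil ru.
  have ab : a = b by have := valP u; rewrite u0 => /eqP.
  subst a; have v0 : val v = [::] := acyclic QF (valP v).
  have -> : u = v by apply: val_inj; rewrite u0 v0.
  by rewrite eqxx YX ?v0 // castv_id /phi v0 /= castv_id phi0x.
pose enumU a := projT1 (cid2 (qpath_enum QF a b)).
apply: (@indecomposable_iso_J k Q I U cns cns_inj phi Y enumU) => //.
- by move=> a; rewrite /enumU; case: cid2.
- by move=> a u; rewrite /enumU; case: cid2.
- by exists b; constructor; exact: trivial_path.
Qed.

End Socle.

(** * Rays *)

Lemma castv_pact (k : fieldType) (Q : quiver) (M : rep k Q) w a b c (x : M a) :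
  b = c -> castv M b c (pact M w a b x) = pact M w a c x.
Proof. by move=> bc; subst c; rewrite castv_id. Qed.

Section Ray.
Variables (k : fieldType) (Q : quiver) (I : rep k Q) (p : left_path Q).
Hypothesis QF : interval_finite Q.
Hypothesis arr_surj : forall v : forall be, I (target be),
  exists z : forall a, I a, forall be, act I be (z (source be)) = v be.
Hypothesis ray_out : forall n (be : arrow Q),
  source be = source (val p n) -> be = val p n.
Hypothesis ray_inj : forall n z, act I (val p n) z = 0 -> z = 0.

Let c n := source (val p n).
Let U (a : vertex Q) : choiceType := left_class p a.
Let cns (al : arrow Q) : U (target al) -> U (source al) := @left_before Q p al.

Let left_pathP (u : left_path Q) i : source (val u i.+1) = target (val u i).
Proof. by case: u => u /= /asboolP. Qed.

Let on_ray (u : left_path Q) m n := forall i, val u (m + i)%N = val p (n + i)%N.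

Let on_ray_uniq u m n n' : on_ray u m n -> on_ray u m n' -> n = n'.
Proof.
move=> /(_ 0%N) un /(_ 0%N); rewrite un !addn0 => nn'.
by apply: (left_path_source_inj QF (u := p)); rewrite nn'.
Qed.

Let on_ray_add u m n j : on_ray u m n -> on_ray u (m + j) (n + j).
Proof. by move=> umn i; rewrite -!addnA umn. Qed.

Let ray_map n (z : I (c 0)) : I (c n) := pact I (mkseq (val p) n) (c 0) (c n) z.

Let ray_mapS n z :
  ray_map n.+1 z = castv I (target (val p n)) (c n.+1) (act I (val p n) (ray_map n z)).
Proof. by rewrite /ray_map mkseqS pact_rcons_cast. Qed.

Let ray_map_inj n z : ray_map n z = 0 -> z = 0.
Proof.
elim: n => [|n IHn]; first by rewrite /ray_map pact_nil.
rewrite ray_mapS => /castv_eq0 h; apply/IHn/ray_inj/h.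
by rewrite /c left_pathP.
Qed.

Let ray_map_surj n y : exists z, ray_map n z = y.
Proof.
elim: n y => [|n IHn] y; first by exists y; rewrite /ray_map pact_nil.
have [z zP] := arr_surj (fun be => castv I (c n.+1) (target be) y).
have [x xP] := IHn (z (c n)); exists x.
rewrite ray_mapS xP zP; have e := left_pathP p n.
by move: y {z zP xP}; rewrite /c e => y; rewrite !castv_id.
Qed.

Variables (x0 : I (c 0)) (phi0 : {linear I (c 0) -> k^o}).
Hypothesis phi0_x0 : phi0 x0 = 1.

(** Transports [phi0] along the ray, on which the action is bijective. *)
Let psiP n : exists psi : {linear I (c n) -> k^o},
  forall z, psi (ray_map n z) = phi0 z.
Proof.
apply: functional_bij (pact I (mkseq (val p) n) (c 0) (c n)) _ _ (@ray_map_surj n).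
move=> z z' /eqP; rewrite -subr_eq0 -linearB => /eqP/ray_map_inj/eqP.
by rewrite subr_eq0 => /eqP.
Qed.

Let psi n := projT1 (cid (psiP n)).

Let psiE n z : psi n (ray_map n z) = phi0 z.
Proof. by rewrite /psi; case: cid. Qed.

Let psiS n z :
  psi n.+1 (castv I (target (val p n)) (c n.+1) (act I (val p n) z)) = psi n z.
Proof. by have [y <-] := ray_map_surj z; rewrite -ray_mapS !psiE. Qed.

Let phi_at (u : left_path Q) m n a : {linear I a -> k^o} :=
  psi n \o pact I (mkseq (val u) m) a (c n).

Let phi_atE u m n a z :
  phi_at u m n a z = psi n (pact I (mkseq (val u) m) a (c n) z).
Proof. by []. Qed.

Let phi_at_add u m n j a z : on_ray u m n ->
  phi_at u (m + j) (n + j) a z = phi_at u m n a z.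
Proof.
move=> umn; elim: j => [|j <-]; first by rewrite !addn0.
rewrite !addnS !phi_atE mkseqS pact_rcons_cast.
by rewrite (umn j) psiS.
Qed.

(** Advancing both positions changes nothing, and the position in [u] determines the one in [p]. So
    [phi] does not depend on the chosen point where [u] joins the ray. *)
Let phi_at_uniq u m n m' n' a z : on_ray u m n -> on_ray u m' n' ->
  phi_at u m n a z = phi_at u m' n' a z.
Proof.
wlog mm' : m n m' n' / (m <= m')%N => [H|] umn um'n'.
  by case/orP: (leq_total m m') => mm'; [apply: H | apply/esym/H].
rewrite -(phi_at_add (m' - m) z umn) subnKC //.
congr (phi_at _ _ _ _ z); apply: on_ray_uniq um'n'.
by rewrite -{1}(subnKC mm'); apply: on_ray_add.
Qed.

Let classP a (u : U a) : exists mn : nat * nat, on_ray (val u) mn.1 mn.2.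
Proof. by have /andP[/asboolP[m [n umn]] _] := valP u; exists (m, n). Qed.

Let class_source a (u : U a) : source (val (val u) 0%N) = a.
Proof. by have /andP[_ /eqP] := valP u. Qed.

Let phi a (u : U a) : {linear I a -> k^o} :=
  phi_at (val u) (projT1 (cid (classP u))).1 (projT1 (cid (classP u))).2 a.

Let phiE a (u : U a) m n z : on_ray (val u) m n -> phi u z = phi_at (val u) m n a z.
Proof.
by move=> umn; rewrite /phi; case: cid => -[m' n'] /= um'n'; apply: phi_at_uniq.
Qed.

Let phi_cns al (u : U (target al)) (z : I (source al)) :
  phi (cns u) z = phi u (act I al z).
Proof.
have [[m n] /= umn] := classP u.
have cumn : on_ray (val (cns u)) m.+1 n by [].
apply: etrans (phiE z cumn) (etrans _ (esym (phiE (act I al z) umn))).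
rewrite !phi_atE; congr (psi n _).
rewrite /mkseq /= -[iota 1 m]/(iota (1 + 0) m) iotaDl -map_comp.
by rewrite castv_id.
Qed.

Let onr a (u : U a) m := exists n, on_ray (val u) m n.

Let rkP a (u : U a) : exists m, `[< onr u m >].
Proof. by have [[m n] umn] := classP u; exists m; apply/asboolP; exists n. Qed.

(** Least number of arrows to strip from [u] to land on the ray, in the role of the length of a
    path. *)
Let rk a (u : U a) : nat := ex_minn (rkP u).

Let rk_onr a (u : U a) : onr u (rk u).
Proof. by rewrite /rk; case: ex_minnP => m /asboolP. Qed.

Let rk_min a (u : U a) m : onr u m -> (rk u <= m)%N.
Proof. by move=> um; rewrite /rk; case: ex_minnP => r _; apply; apply/asboolP. Qed.

Let uncons a (u : U a) : exists al (v : U (target al)),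
  al = val (val u) 0%N /\
  existT (fun a => U a : Type) a u = existT _ (source al) (cns v).
Proof.
case: u => u uP; have /andP[/asboolP[m [n umn]] /eqP ua] := uP; subst a.
exists (val u 0%N).
have tlP : `[< is_left_path (fun i => val u i.+1) >].
  by apply/asboolP => i; apply: left_pathP.
pose tl : left_path Q := exist (fun p => `[< is_left_path p >]) _ tlP.
have tlU : `[< left_equiv tl p >] && (left_source tl == target (val u 0%N)).
  apply/andP; split; last by rewrite /left_source /= left_pathP.
  by apply/asboolP; exists m, n.+1 => i; rewrite /= -addnS umn addnS.
exists (exist _ tl tlU); split => //; congr existT.
by apply/val_inj/val_inj/funext => -[|i].
Qed.

Let cns_inj al : injective (@cns al).
Proof.
move=> u v uv; apply/val_inj/val_inj/funext => i.
by have := congr1 (fun w => val (val w) i.+1) uv.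
Qed.

Let rk_cns0 al (v : U (target al)) : rk (cns v) = 0%N -> rk v = 0%N.
Proof.
move=> r0; have [n un] := rk_onr (cns v); rewrite r0 in un.
apply/eqP; rewrite -leqn0; apply: rk_min; exists n.+1 => i.
by rewrite addSnnS -(un i.+1).
Qed.

Let rk_cnsS al (v : U (target al)) : rk (cns v) <> 0%N -> rk (cns v) = (rk v).+1.
Proof.
move=> r0; apply/eqP; rewrite eqn_leq; apply/andP; split.
  by apply: rk_min; have [n vn] := rk_onr v; exists n.
have [n] := rk_onr (cns v); case: (rk (cns v)) r0 => // m _ un.
by rewrite ltnS; apply: rk_min; exists n.
Qed.

(** 0 is a default off the ray; elements of rank 0 follow the ray from their start. *)
Let X a (u : U a) : I a :=
  if pselect (onr u 0) is left h then
    pact I (mkseq (val p) (projT1 (cid h))) (c 0) a x0 else 0.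

Let XE a (u : U a) n : on_ray (val u) 0 n ->
  X u = pact I (mkseq (val p) n) (c 0) a x0.
Proof.
move=> un; rewrite /X; case: pselect => [h|[]]; last by exists n.
by case: cid => n' /= /(on_ray_uniq un) ->.
Qed.

Let act_X al (v : U (target al)) : rk (cns v) = 0%N -> act I al (X (cns v)) = X v.
Proof.
move=> r0; have [n un] := rk_onr (cns v); rewrite r0 in un.
have vn : on_ray (val v) 0 n.+1 by move=> i; rewrite addSnnS -(un i.+1).
rewrite (XE un) (XE vn) mkseqS.
have -> : val p n = al by rewrite -[n]addn0 -(un 0%N).
by rewrite pact_rcons.
Qed.

(** Vacuous: the first arrow of [u] is the only one leaving its source, so [u] has the form
    [cns v]. *)
Let act_X0 al (u : U (source al)) : rk u = 0%N ->
  (forall v : U (target al), u <> cns v) -> act I al (X u) = 0.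
Proof.
move=> r0 uN; exfalso; have [n un] := rk_onr u; rewrite r0 in un.
have [be [v [be0 uv]]] := uncons u.
have bep : be = val p n by rewrite be0 (un 0%N) addn0.
have albe : al = be.
  by rewrite bep; apply: ray_out; rewrite -bep be0 class_source.
by clear be0 bep; subst be; exact: (uN v (existT_inj uv)).
Qed.

(** Each vertex of the ray emits a single arrow, so a left infinite path starting there must follow
    [p]. *)
Let ray_uniq a (u v : U a) : rk u = 0%N -> u = v.
Proof.
move=> r0; have [n un] := rk_onr u; rewrite r0 in un.
apply/val_inj/val_inj/funext => i; rewrite -[i]add0n un.
suff sv : source (val (val v) i) = source (val p (n + i)%N).
  by rewrite -(ray_out sv).
elim: i => [|i IHi]; first by rewrite class_source -(un 0%N) class_source.
by rewrite left_pathP (ray_out IHi) addnS left_pathP.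
Qed.

Lemma ray_iso_Y_rep :
  (forall a, exists2 s : seq (left_class p a), uniq s & forall u, u \in s) ->
  indecomposable_in (@finitely_presented k Q) I -> rep_iso I (Y_rep k p).
Proof.
move=> Ufin Iind.
have [Y [YX act_Y act_Y0]] := exists_dual_family cns_inj rk_cns0 rk_cnsS
  act_X act_X0 arr_surj.
have phi_Y a (u v : U a) : phi u (Y a v) = (u == v)%:R.
  apply: (dual_family_biorthogonal cns_inj rk_cnsS phi_cns act_Y act_Y0).
    by move=> b w _; have [al [v' [_ E]]] := uncons w; exists al, v'.
  move=> b w w' r0; rewrite -(ray_uniq w' r0) eqxx YX //.
  have [n un] := rk_onr w; rewrite r0 in un.
  rewrite (XE un) (phiE _ un) phi_atE.
  have bc : b = c n by rewrite -(class_source w) (un 0%N) addn0.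
  by rewrite castv_pact // psiE phi0_x0.
pose enumU a := projT1 (cid2 (Ufin a)).
apply: (@indecomposable_iso_J k Q I U cns cns_inj phi Y enumU) => //.
- by move=> a; rewrite /enumU; case: cid2.
- by move=> a u; rewrite /enumU; case: cid2.
- have pP : `[< left_equiv p p >] && (left_source p == left_source p).
    by rewrite eqxx andbT; apply/asboolP; exists 0%N, 0%N.
  by exists (left_source p); constructor; exact: (exist _ p pP).
Qed.

End Ray.

(** * Conclusion *)

Section Conclusion.
Variables (k : fieldType) (Q : quiver).

Lemma rep_iso_supp (M N : rep k Q) : rep_iso M N -> supp M = supp N.
Proof.
move=> [f [g [gf fg]]]; apply/seteqP; split=> a [x x0].
  exists (f a x) => fx; apply: x0.
  by have := gf a x; rewrite hom_compE fx linear0.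
exists (g a x) => gx; apply: x0.
by have := fg a x; rewrite hom_compE gx linear0.
Qed.

(** Each vertex of the support has an arrow to another one, which yields an infinite walk. By
    acyclicity its vertices are distinct, so from some [N] on they avoid the sources of arrows in
    [E]. *)
Lemma exists_ray (I : rep k Q) (E : seq (arrow Q)) c0 :
  interval_finite Q ->
  (forall b (x : I b), x <> 0 ->
    exists al : arrow Q, act I al (castv I b (source al) x) <> 0) ->
  supp I c0 ->
  exists p : left_path Q, forall n, supp I (source (val p n)) /\
    source (val p n) \notin map (@source Q) E.
Proof.
move=> QF nosoc sc0.
have next c : supp I c -> exists al : arrow Q, source al = c /\ supp I (target al).
  move=> [x /nosoc[al alx]]; exists al; split; last by eexists; exact: alx.
  apply: contrapT => alc; apply: alx.
  by rewrite /castv; case: eqP => [/esym//|_]; rewrite !linear0.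
have [al0 _] := next _ sc0.
(* [al0] is the default outside the support, so that [choice] yields a total function. *)
have next' c : exists al : arrow Q, supp I c -> source al = c /\ supp I (target al).
  have [/next[al alP]|nsc] := pselect (supp I c); first by exists al.
  by exists al0.
have [f fP] := choice next'.
pose v := fix v n := if n is n'.+1 then target (f (v n')) else c0.
have vP n : supp I (v n) by elim: n => //= n /fP[].
have fv n : source (f (v n)) = v n by have [] := fP _ (vP n).
have rP N : `[< is_left_path (fun n => f (v (N + n)%N)) >].
  by apply/asboolP => i; rewrite fv addnS.
pose r N : left_path Q := exist (fun p => `[< is_left_path p >]) _ (rP N).
have vinj : injective v.
  by move=> i j ij; apply: (left_path_source_inj QF (u := r 0%N)); rewrite /= !fv.
have [N NP] := injective_eventually_notin (map (@source Q) E) vinj.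
by exists (r N) => n; rewrite /= fv; split; [exact: vP | apply/NP/leq_addr].
Qed.

End Conclusion.

Theorem theorem3p11 (k : fieldType) (Q : quiver) (I : rep k Q) :
  interval_finite Q ->
  indecomposable_in (@finitely_presented k Q) I ->
  injective_in (@finitely_presented k Q) I ->
  (exists a : vertex Q,
     [/\ rep_iso I (I_rep k a),
         finite_set (predecessors a) &
         forall b, predecessors a b -> finite_set (out_vertices b)])
  \/
  (exists p : left_path Q,
     [/\ rep_iso I (Y_rep k p),
         top_finite (full_subquiver (supp (Y_rep k p))),
         uniformly_interval_finite (full_subquiver (supp (Y_rep k p))) &
         finite_set ((\bigcup_(a in supp (Y_rep k p)) out_vertices a)
                       `\` supp (Y_rep k p))]).
Proof.
move=> QF Iind Iinj; have [fpI nz _] := Iind.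
have [gen supp_gen] : exists gen : seq (vertex Q), forall c, supp I c ->
    exists2 a, a \in gen & predecessors c a.
  by apply: finitely_generated_supp; have [s [f [fe _]]] := fpI; exists s, f.
have [V act_inj] := finitely_presented_act_inj fpI.
have out_surj := injective_arrows_surj Iinj.
have [E branching] := branching_enum QF supp_gen V.
have arr_surj := arrows_surj act_inj out_surj branching.
have [[b [x [x0 soc]]]|nosoc] := pselect (exists b (x : I b), x <> 0 /\
    forall al : arrow Q, act I al (castv I b (source al) x) = 0).
  have sb : supp I b by exists x.
  left; exists b; split.
  - exact: socle_iso_I_rep x0 soc Iind.
  - exact (finite_predecessors QF supp_gen out_surj sb).
  - move=> c [[w wP] _].
    exact (finite_out_vertices act_inj out_surj branching (supp_path out_surj wP sb)).
right.
have [c0 sc0] : exists c, supp I c.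
  apply: contrapT => nsupp; apply: nz => a x; apply: contrapT => x0.
  by apply: nsupp; exists a, x.
have [|p pP] := @exists_ray k Q I E c0 QF _ sc0.
  move=> b x x0; apply: contrapT => noal; apply: nosoc; exists b, x; split=> // al.
  by apply: contrapT => alx; apply: noal; exists al.
(* No arrow of [E] starts on the ray; hence a single arrow leaves each of its vertices and ends
   outside [V], where the action is injective. *)
have notE n al : source al = source (val p n) -> al \notin E.
  by move=> alp; have [_] := pP n; apply: contra => alE; rewrite -alp map_f.
have ray_out n be : source be = source (val p n) -> be = val p n.
  move=> bep; apply: (nonbranching_unique act_inj out_surj branching) => //.
  - by rewrite bep; have [] := pP n.
  - exact: notE bep.
  - exact: notE erefl.
have ray_inj n z : act I (val p n) z = 0 -> z = 0.
  apply: act_inj; apply/negP => pV.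
  have /negP := notE n (val p n) erefl; apply.
  by apply: branching pV; have [] := pP n.
have [[x x0] _] := pP 0%N; have [phi phix] := functional_neq0 x0.
have IY : rep_iso I (Y_rep k p).
  apply: (ray_iso_Y_rep QF arr_surj ray_out ray_inj phix) => // a.
  (* Finiteness of the class at [a]: each member joins the ray, hence runs inside the support, and
     is determined by the arrows of [E] it uses. *)
  pose code (u : left_class p a) := map_tuple
    (fun al => `[< exists i, val (val u) i = al >]) (in_tuple E).
  apply: (@injective_finType_enum _ _ code) => u v /(congr1 val) /= /eq_in_map uv.
  have usupp (w : left_class p a) i : supp I (source (val (val w) i)).
    have /andP[/asboolP[m [n wp]] _] := valP w.
    apply: (supp_path out_surj (left_path_sub (val w) i m)).
    by rewrite addnC wp; have [] := pP (n + i)%N.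
  apply: val_inj.
  apply: (left_path_code_inj QF act_inj out_surj branching (usupp u)).
    have /andP[_ /eqP ->] := valP u.
    by have /andP[_ /eqP ->] := valP v.
  by move=> al alE; apply: asbool_eq_equiv; exact: uv alE.
exists p; rewrite -(rep_iso_supp IY); split=> //.
- exact (supp_top_finite supp_gen out_surj).
- exact (supp_uniformly_interval_finite QF act_inj out_surj branching).
- exact (finite_boundary act_inj).
Qed.
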